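(* Let $f:\mathbb{R}^n\to\mathbb{R}$ be strictly convex and twice continuously differentiable with $\nabla^2 f(x)\succ0$ for all $x$, and suppose $f$ attains its minimum at some point $x^*$ (which is then unique) with $f(x^* )>-\infty$. Let $g=g_p+g_q:\mathbb{R}^n\to\mathbb{R}^n$ with $g_p\in\mathcal{F}_p^{\sigma}$, $g_q\in\mathcal{F}_q^{\rho}$, where $p\in[0,1)$, $q>1$, $\sigma,\rho>0$. Put $u(x)=(\nabla^2 f(x))^{-1}g(\nabla f(x))$. Then any Filippov solution $x(t)$ of $\dot x=-u(x)$ starting from any initial state $x(0)=x_0\in\mathbb{R}^n$ converges to $x^*$ in fixed time $T(x_0)$ bounded by $$T(x_0)\le\frac{1}{\sigma(1-p)}+\frac{1}{\rho(q-1)}.$$ Moreover, $u(x(t))$ is measurable and locally essentially bounded over $[0,T(x_0)]$.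
   Context: For a measurable, locally essentially bounded map $X:\mathbb{R}^n\to\mathbb{R}^n$, the Filippov set-valued map is $\mathcal{F}[X](x)=\bigcap_{\delta>0}\bigcap_{\omega(\mathcal{N}_0)=0}\overline{co}\{X(x^{\delta}\setminus\mathcal{N}_0)\}$, where $x^\delta$ is the open ball of radius $\delta$ centered at $x$, $\omega$ is Lebesgue measure, and $\overline{co}$ is the closed convex hull. A Filippov solution of $\dot x=X(x)$, $x(0)=x_0$, is a (locally) absolutely continuous $x:[0,\infty)\to\mathbb{R}^n$ with $x(0)=x_0$ and $\dot x(t)\in\mathcal{F}[X](x(t))$ for a.e. $t$. A function $g:\mathbb{R}^n\to\mathbb{R}^n$ is sign-preserving if $\mathrm{sign}(g(y))=\mathrm{sign}(y)$ (componentwise signum, $\mathrm{sign}(0)=0$) for all $y$. For $p\ge0$ and $\sigma>0$, $g_p\in\mathcal{F}_p^{\sigma}$ means that $g_p:\mathbb{R}^n\to\mathbb{R}^n$ is measurable, locally essentially bounded, sign-preserving, and $\min_{\eta\in\mathcal{F}[g_p](y)}\eta^Ty\ge\sigma\|y\|_2^{1+p}$ for all $y\in\mathbb{R}^n$. ''$x(t)$ converges to $x^*$ in time $T(x_0)$'' means $x(t)=x^*$ for all $t\ge T(x_0)$.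
   Formalization: In the ''Moreover'' clause u(x(t)) means any v(t) in F[u](x(t)) with x'(t) = -v(t) a.e. (such v exists), not the pointwise value, since g may be unbounded or non-measurable on the null set traced by x(t), which makes the pointwise claim false. *)

(* Defs.v *)
(* MathComp / MathComp-Analysis; vectors of R^n are row vectors 'rV[R]_n. *)
From HB Require Import structures.
From mathcomp Require Import all_boot all_order all_algebra.
From mathcomp Require Import all_classical all_reals all_analysis.

Set Implicit Arguments.
Unset Strict Implicit.
Unset Printing Implicit Defensive.

Import Order.TTheory GRing.Theory Num.Theory.
Import numFieldNormedType.Exports.

Local Open Scope classical_set_scope.
Local Open Scope ring_scope.

(* The library norm `|x| on 'rV[R]_n is the sup norm, hence [enorm]. *)
Definition dot (R : realType) (n : nat) (x y : 'rV[R]_n) : R :=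
  \sum_(i < n) x 0 i * y 0 i.

Definition enorm (R : realType) (n : nat) (x : 'rV[R]_n) : R :=
  Num.sqrt (dot x x).

Definition eball (R : realType) (n : nat) (x : 'rV[R]_n) (d : R) :
    set 'rV[R]_n :=
  [set y | enorm (y - x) < d].

Definition box (R : realType) (n : nat) (a b : 'rV[R]_n) : set 'rV[R]_n :=
  [set y | forall i, a 0 i <= y 0 i <= b 0 i].

Definition box_volume (R : realType) (n : nat) (a b : 'rV[R]_n) : R :=
  \prod_(i < n) Num.max 0 (b 0 i - a 0 i).

(* n-dimensional Lebesgue outer measure (for 0 < n), by countable covers with
   closed boxes. Its null sets are the Lebesgue-null sets, and its
   Caratheodory-measurable sets are the Lebesgue-measurable sets. *)
Definition lebesgue_outer (R : realType) (n : nat) (A : set 'rV[R]_n) :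
    \bar R :=
  ereal_inf [set s | exists a b : nat -> 'rV[R]_n,
    A `<=` \bigcup_k box (a k) (b k) /\
    s = (\sum_(0 <= k <oo) (box_volume (a k) (b k))%:E)%E].

(* [mu] is an outer measure: [lebesgue_outer] on R^n, or the library's
   [lebesgue_measure] on R, which is total on sets and is the outer measure
   extending the length of intervals. Measurability and null sets are thus
   those of the complete Lebesgue measure. *)
Definition measurable_map (R : realType) (T : Type) (mu : set T -> \bar R)
    (D : set T) (n : nat) (X : T -> 'rV[R]_n) : Prop :=
  forall U : set 'rV[R]_n, open U -> mu.-caratheodory (D `&` X @^-1` U).

Definition locally_ess_bounded (R : realType) (T : topologicalType)
    (mu : set T -> \bar R) (D : set T) (n : nat) (X : T -> 'rV[R]_n) : Prop :=
  forall x, D x -> exists2 U : set T, nbhs x U &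
    exists M : R, mu (U `&` D `&` [set y | M < enorm (X y)]) = 0%E.

Definition closed_convex_hull (R : realType) (n : nat) (A : set 'rV[R]_n) :
    set 'rV[R]_n :=
  smallest [set C : set 'rV[R]_n | closed C /\ convex_set C] A.

Definition filippov (R : realType) (n : nat) (X : 'rV[R]_n -> 'rV[R]_n)
    (x : 'rV[R]_n) : set 'rV[R]_n :=
  \bigcap_(d in [set d : R | 0 < d])
    \bigcap_(N in [set N : set 'rV[R]_n | lebesgue_outer N = 0%E])
      closed_convex_hull (X @` (eball x d `\` N)).

Definition abs_continuous_on (R : realType) (n : nat) (a b : R)
    (x : R -> 'rV[R]_n) : Prop :=
  forall e : R, 0 < e -> exists2 d : R, 0 < d &
    forall (m : nat) (s t : 'I_m -> R),
      (forall i, [/\ a <= s i, s i <= t i & t i <= b]) ->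
      trivIset [set: 'I_m] (fun i => `]s i, t i[%classic) ->
      \sum_(i < m) (t i - s i) < d ->
      \sum_(i < m) enorm (x (t i) - x (s i)) < e.

(* Only the restriction of [x] to [0, +oo[ matters. *)
Definition filippov_solution (R : realType) (n : nat)
    (X : 'rV[R]_n -> 'rV[R]_n) (x0 : 'rV[R]_n) (x : R -> 'rV[R]_n) : Prop :=
  [/\ x 0 = x0,
      forall b : R, 0 < b -> abs_continuous_on 0 b x &
      {ae @lebesgue_measure R, forall t : R, 0 <= t ->
         derivable x t 1 /\ filippov X (x t) (x^`()%classic t)}].

(* [v] is a value of the discontinuous feedback [u] along a solution [x] of
   x' = - u(x): a pointwise u (x t) depends on the values of [u] on the curve,
   a null set that the differential inclusion does not see, so [v] is only
   required to lie in F[u](x(t)) and to satisfy x' = - v almost everywhere.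
   [v := u \o x] qualifies whenever x'(t) = - u(x(t)) holds in this sense. *)
Definition feedback_along (R : realType) (n : nat)
    (u : 'rV[R]_n -> 'rV[R]_n) (x v : R -> 'rV[R]_n) : Prop :=
  {ae @lebesgue_measure R, forall t : R, 0 <= t ->
     [/\ filippov u (x t) (v t), derivable x t 1 & x^`()%classic t = - v t]}.

Definition sign_preserving (R : realType) (n : nat)
    (g : 'rV[R]_n -> 'rV[R]_n) : Prop :=
  forall y i, Num.sg (g y 0 i) = Num.sg (y 0 i).

Definition class_F (R : realType) (n : nat) (p sigma : R)
    (g : 'rV[R]_n -> 'rV[R]_n) : Prop :=
  [/\ measurable_map (@lebesgue_outer R n) setT g,
      locally_ess_bounded (@lebesgue_outer R n) setT g,
      sign_preserving g &
      forall y, exists eta, [/\ filippov g y eta,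
        forall eta', filippov g y eta' -> dot eta y <= dot eta' y &
        sigma * enorm y `^ (1 + p) <= dot eta y]].

Definition strictly_convex (R : realType) (n : nat) (f : 'rV[R]_n -> R) :
    Prop :=
  forall (x y : 'rV[R]_n) (t : R), x != y -> 0 < t < 1 ->
    f (t *: x + (1 - t) *: y) < t * f x + (1 - t) * f y.

Definition grad (R : realType) (n : nat) (f : 'rV[R]_n -> R) (x : 'rV[R]_n) :
    'rV[R]_n :=
  \row_(i < n) 'D_(delta_mx 0 i) f x.

(* [hess f x] has entries d_i d_j f (x) and acts on row vectors:
   'D_v (grad f) x = v *m hess f x. *)
Definition hess (R : realType) (n : nat) (f : 'rV[R]_n -> R) (x : 'rV[R]_n) :
    'M[R]_n :=
  'J (grad f) x.

Definition twice_cont_diff (R : realType) (n : nat) (f : 'rV[R]_n -> R) :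
    Prop :=
  [/\ forall x, differentiable f x,
      forall x, differentiable (grad f) x &
      continuous (hess f)].

(* Symmetry is not asked: it is automatic for the Hessian of a C^2 function. *)
Definition posdef (R : realType) (n : nat) (A : 'M[R]_n) : Prop :=
  forall v : 'rV[R]_n, v != 0 -> 0 < dot (v *m A) v.

(* Main.v *)
Require Import Defs.
From HB Require Import structures.
From mathcomp Require Import all_boot all_order all_algebra.
From mathcomp Require Import all_classical all_reals all_analysis.
From mathcomp Require Import ring lra.

(** Write [G] for the gradient of [f], [J] for its Hessian, [y = G (x t)] and
    [E = |y|^2]. If [x'] were equal to [- u (x)], then [y' = x' J] would be
    [- g y], and the lower bounds on [gp] and [gq] would give
    [E' <= - 2 (sigma |y|^(1+p) + rho |y|^(1+q))]. The term in [q] alone brings [E]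
    below 1 within time [1 / (rho (q - 1))], however large it is at first, and the
    term in [p] alone then brings it to 0 within time [1 / (sigma (1 - p))]; a positive
    definite Hessian makes [G] injective, so that [y = 0] forces [x = xstar].
    The sum of the two delays bounds the settling time for every initial state,
    and serves as [T]. Three points make this rigorous.

    First, the differential inclusion. [G] has, locally, a Lipschitz left inverse
    (strict differentiability and invertibility of the Hessian), so preimages of
    null sets under [G] are null ([ess_near_preimage]); what [g] satisfies almost
    everywhere near [G x] is inherited by [u] almost everywhere near [x]. Together
    with the upper semicontinuity of Filippov's map in a fixed direction
    ([filippov_halfspace_usc]) this shows that any velocity allowed by the
    inclusion satisfies the dissipation inequality ([feedback_dissipation]).
    Scalar products with the single vector [y] suffice, hence half-spaces are the
    only convex sets needed there.

    Second, the comparison argument. A function of an absolutely continuous curve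
    whose derivative is at most [k] almost everywhere increases at rate at most
    [k] ([abs_continuous_comp_derive_le]). It is applied to [E], and to the powers
    of [E] that linearise the two differential inequalities
    ([energy_power_decrease]).

    Third, the values [v] of the feedback along the solution. Almost everywhere
    [v = - x'], a pointwise limit of continuous difference quotients, hence [v] is
    measurable ([derivative_measurable_map]). It is locally bounded because
    Filippov's map of a locally essentially bounded field is locally bounded
    ([feedback_filippov_bounded]). *)

Set Implicit Arguments.
Unset Strict Implicit.
Unset Printing Implicit Defensive.

Import Order.TTheory GRing.Theory Num.Theory.
Import numFieldNormedType.Exports.

Local Open Scope classical_set_scope.
Local Open Scope ring_scope.

(** * Lebesgue outer measure and null sets *)

Section OuterMeasure.
Variables (R : realType) (n : nat).
Implicit Types (a b : 'rV[R]_n) (A : set 'rV[R]_n).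

Lemma box_volume_ge0 a b : 0 <= box_volume a b.
Proof. by apply: prodr_ge0 => i _; rewrite le_max lexx. Qed.

Local Open Scope ereal_scope.

Lemma volume_series_ge0 (c d : nat -> 'rV[R]_n) :
  0 <= \sum_(0 <= k <oo) (box_volume (c k) (d k))%:E.
Proof. by apply: nneseries_ge0 => k _ _; rewrite lee_fin box_volume_ge0. Qed.

Lemma lebesgue_outer_le A (c d : nat -> 'rV[R]_n) :
  A `<=` \bigcup_k box (c k) (d k) ->
  lebesgue_outer A <= \sum_(0 <= k <oo) (box_volume (c k) (d k))%:E.
Proof. by move=> Acd; apply: ereal_inf_lbound; exists c, d. Qed.

Lemma lebesgue_outer_ge0 A : 0 <= lebesgue_outer A.
Proof.
by apply: le_ereal_inf_tmp => _ [c [d [_ ->]]]; exact: volume_series_ge0.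
Qed.

Lemma lebesgue_outer_mono :
  {homo @lebesgue_outer R n : A B / A `<=` B >-> A <= B}.
Proof.
move=> A B AB; apply: ereal_inf_le_tmp => _ [c [d [Bcd ->]]].
by exists c, d; split => //; exact: subset_trans AB Bcd.
Qed.

Lemma lebesgue_outer_le2 A (c d : nat -> nat -> 'rV[R]_n) :
  A `<=` \bigcup_i \bigcup_j box (c i j) (d i j) ->
  lebesgue_outer A <=
    \sum_(0 <= i <oo) \sum_(0 <= j <oo) (box_volume (c i j) (d i j))%:E.
Proof.
move=> Acd.
have vol0 (k : nat * nat) :
    0 <= (box_volume (c k.1 k.2) (d k.1 k.2))%:E.
  by rewrite lee_fin box_volume_ge0.
rewrite nneseries_esumT => [|i]; last first.
  by apply: nneseries_ge0 => j _ _; exact: (vol0 (i, j)).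
have -> : \esum_(i in [set: nat]) \sum_(0 <= j <oo)
      (box_volume (c i j) (d i j))%:E =
    \esum_(i in [set: nat]) \esum_(j in [set: nat])
      (box_volume (c i j) (d i j))%:E.
  by apply: eq_esum => i _; rewrite nneseries_esumT// => j; exact: (vol0 (i, j)).
rewrite esum_esum; last by move=> i j _ _; exact: (vol0 (i, j)).
have /card_esym/card_set_bijP[e ebij] := card_nat2.
rewrite (_ : _ `*`` _ = [set: nat * nat]); last first.
  by apply/seteqP; split => // -[].
rewrite (reindex_esum _ _ _ _ ebij) -nneseries_esumT; last by move=> k; exact: vol0.
apply: (lebesgue_outer_le (c := fun k => c (e k).1 (e k).2)
  (d := fun k => d (e k).1 (e k).2)) => y /Acd [i _ [j _ yij]].
by have [_ _ /(_ (i, j) I)[k _ ek]] := ebij; exists k => //; rewrite ek.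
Qed.

End OuterMeasure.

Section OuterMeasureInstance.
Variables (R : realType) (n : nat).
Local Open Scope ereal_scope.

(** In dimension zero the volume, an empty product, would be 1. *)
Lemma box_volume_diag (a : 'rV[R]_n.+1) : box_volume a a = 0%R.
Proof. by rewrite /box_volume big_ord_recl subrr maxxx mul0r. Qed.

Lemma lebesgue_outer0 : @lebesgue_outer R n.+1 set0 = 0.
Proof.
apply/eqP; rewrite eq_le lebesgue_outer_ge0 andbT.
apply: (le_trans (lebesgue_outer_le (c := fun=> 0%R) (d := fun=> 0%R) _)) => //.
by rewrite eseries0// => k _ _; rewrite box_volume_diag.
Qed.

Lemma lebesgue_outer_sigma_subadditive :
  sigma_subadditive (@lebesgue_outer R n.+1).
Proof.
move=> F; apply/lee_addgt0Pr => e e_gt0.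
rewrite (le_trans _ (epsilon_trick xpredT _ (ltW e_gt0)))//; last first.
  by move=> k; exact: lebesgue_outer_ge0.
pose tol k : R := (e / (2 ^ k.+1)%:R)%R.
have tol_gt0 k : (0 < tol k)%R by rewrite divr_gt0// ltr0n expn_gt0.
have [[i Fi]|Ffin] := pselect (exists i, lebesgue_outer (F i) = +oo).
  rewrite (eseries_pinfty _ _ (k := i)) ?leey//.
    move=> k _; rewrite -ltNye.
    by rewrite (lt_le_trans _ (adde_ge0 (lebesgue_outer_ge0 _) _))// lee_fin ltW// tol_gt0.
  by rewrite Fi.
have cover k : {cd : (nat -> 'rV[R]_n.+1) * (nat -> 'rV[R]_n.+1) |
    F k `<=` \bigcup_j box (cd.1 j) (cd.2 j) /\
    \sum_(0 <= j <oo) (box_volume (cd.1 j) (cd.2 j))%:E <=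
      lebesgue_outer (F k) + (tol k)%:E}.
  apply: cid.
  have Fk : lebesgue_outer (F k) \is a fin_num.
    rewrite ge0_fin_numE ?lebesgue_outer_ge0// ltey.
    by apply/eqP => Fk; apply: Ffin; exists k.
  have [_ [c [d [Fcd ->]]] /ltW le] := lb_ereal_inf_adherent (tol_gt0 k) Fk.
  by exists (c, d).
pose c k := (projT1 (cover k)).1; pose d k := (projT1 (cover k)).2.
apply: (le_trans (lebesgue_outer_le2 (c := c) (d := d) _)).
  by move=> y [k _ Fky]; exists k => //; exact: (proj1 (projT2 (cover k))).
apply: lee_nneseries => [k _ _|k _]; first exact: volume_series_ge0.
exact: (proj2 (projT2 (cover k))).
Qed.

HB.instance Definition _ := isOuterMeasure.Build R 'rV[R]_n.+1
  (@lebesgue_outer R n.+1) lebesgue_outer0 (@lebesgue_outer_ge0 R n.+1)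
  (@lebesgue_outer_mono R n.+1) lebesgue_outer_sigma_subadditive.

End OuterMeasureInstance.

Lemma outer_measure_big (R : realType) (T : Type) (I : finType) (P : pred I)
    (mu : {outer_measure set T -> \bar R}) (F : I -> set T) :
  (mu (\big[setU/set0]_(i | P i) F i) <= \sum_(i | P i) mu (F i))%E.
Proof.
elim/big_ind2 : _ => [|A a B b Aa Bb|//]; first by rewrite outer_measure0.
exact: le_trans (outer_measureU2 _ _ _) (leeD Aa Bb).
Qed.

Lemma lebesgue_outer_box (R : realType) (n : nat) (A : set 'rV[R]_n.+1) a b :
  A `<=` box a b -> (lebesgue_outer A <= (box_volume a b)%:E)%E.
Proof.
move=> Aab;
pose c (k : nat) : 'rV[R]_n.+1 := if k is 0%N then a else 0.
pose d (k : nat) : 'rV[R]_n.+1 := if k is 0%N then b else 0.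
apply: (le_trans (lebesgue_outer_le (c := c) (d := d) _)).
  by move=> y /Aab; exists 0%N.
rewrite nneseries_recl//; last by move=> *; rewrite lee_fin box_volume_ge0.
by rewrite eseries_cond/= eseries0 ?adde0// => -[|k]//= _ _; rewrite box_volume_diag.
Qed.

Section SupNorm.
Variables (R : realType) (n : nat).

Lemma coord_le_norm (v : 'rV[R]_n) i : `|v 0 i| <= `|v|.
Proof.
by rewrite [leRHS]/Num.Def.normr /= mx_normrE; apply: (le_bigmax _ _ (0, i)).
Qed.

Lemma norm_le_coord (v : 'rV[R]_n) M :
  0 <= M -> (forall i, `|v 0 i| <= M) -> `|v| <= M.
Proof.
move=> M0 vM; rewrite [leLHS]/Num.Def.normr /= mx_normrE; apply/bigmax_leP; split => //.
by move=> [i j] _ /=; rewrite ord1.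
Qed.

End SupNorm.

(** The hypothesis says that [phi] has, on [S], a left inverse with Lipschitz
    constant [L]; what follows bounds the images of boxes under that inverse. *)
Section Transport.
Variables (R : realType) (n : nat).
Variables (phi : 'rV[R]_n.+1 -> 'rV[R]_n.+1) (S : set 'rV[R]_n.+1) (L : R).
Hypotheses (L_ge0 : 0 <= L)
  (phi_expands : forall z z', S z -> S z' -> `|z - z'| <= L * `|phi z - phi z'|).

Let outer := @lebesgue_outer R n.+1.

Lemma outer_preimage_cube (c : 'rV[R]_n.+1) (s : R) : 0 <= s ->
  (outer (S `&` phi @^-1` box c (c + const_mx s)) <=
    ((2 * L) ^+ n.+1 * \prod_(i < n.+1) s)%:E)%E.
Proof.
move=> s_ge0; set Q := _ `&` _.
have [->|/set0P[z0 [Sz0 Qz0]]] := eqVneq Q set0.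
  by rewrite /outer outer_measure0 lee_fin mulr_ge0 ?exprn_ge0 ?mulr_ge0 ?prodr_ge0.
pose a := z0 - const_mx (L * s); pose b := z0 + const_mx (L * s).
have Qab : Q `<=` box a b.
  move=> z [Sz Qz] i.
  have zz0 : `|phi z - phi z0| <= s.
    apply: norm_le_coord => // j; move: (Qz j) (Qz0 j); rewrite !mxE.
    move=> /andP[? ?] /andP[? ?].
    by rewrite ler_norml; apply/andP; split; lra.
  have := le_trans (coord_le_norm (z - z0) i)
    (le_trans (phi_expands Sz Sz0) (ler_wpM2l L_ge0 zz0)).
  by rewrite ler_norml !mxE => /andP[? ?]; apply/andP; split; lra.
apply: (le_trans (lebesgue_outer_box Qab)).
rewrite lee_fin /box_volume -[X in _ ^+ X](card_ord n.+1) -prodr_const -big_split.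
apply: ler_prod => i _; rewrite le_max lexx /= !mxE ge_max.
by apply/andP; split; [rewrite !mulr_ge0|lra].
Qed.

(** The preimage of a cube lies in a comparable cube, but that of a long thin
    box is only controlled by the diameter of the box. Such a box is first cut
    into cubes of side [s], which lengthens each edge by at most [s]. *)
Lemma outer_preimage_box_le (a b : 'rV[R]_n.+1) (s : R) :
  (forall i, a 0 i <= b 0 i) -> 0 < s ->
  (outer (S `&` phi @^-1` box a b) <=
    ((2 * L) ^+ n.+1 * \prod_(i < n.+1) (b 0 i - a 0 i + s))%:E)%E.
Proof.
move=> ab s_gt0; have s_ge0 := ltW s_gt0.
pose m i := (Num.truncn ((b 0 i - a 0 i) / s)).+1.
pose M := (\max_i m i)%N.
have mM i : (m i <= M)%N by rewrite /M; apply: leq_bigmax.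
pose corner (f : {ffun 'I_n.+1 -> 'I_M}) : 'rV[R]_n.+1 :=
  \row_i (a 0 i + (f i)%:R * s).
pose F (f : {ffun 'I_n.+1 -> 'I_M}) :=
  S `&` phi @^-1` box (corner f) (corner f + const_mx s).
pose P (i : 'I_n.+1) := [pred j : 'I_M | (j < m i)%N].
have cover : S `&` phi @^-1` box a b `<=` \big[setU/set0]_(f in family P) F f.
  move=> z [Sz bz].
  pose q i := (phi z 0 i - a 0 i) / s.
  have q_ge0 i : 0 <= q i.
    by rewrite divr_ge0// subr_ge0; have /andP[] := bz i.
  have tm i : (Num.truncn (q i) < m i)%N.
    rewrite ltnS; apply: le_truncn; rewrite ler_pM2r ?invr_gt0// lerD2r.
    by have /andP[] := bz i.
  (* the index of the grid cube that contains [phi z] *)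
  pose f : {ffun 'I_n.+1 -> 'I_M} := [ffun i => Ordinal (leq_trans (tm i) (mM i))].
  rewrite (bigD1 f)/=; last by apply/familyP => i; rewrite inE ffunE/=.
  left; split => // i; rewrite !mxE ffunE/=.
  have /andP[q1 q2] := truncn_itv (q_ge0 i).
  have -> : phi z 0 i = a 0 i + q i * s by rewrite /q divfK ?gt_eqF// addrC subrK.
  rewrite lerD2l -addrA lerD2l ler_pM2r// q1/=.
  by rewrite -[X in _ + X]mul1r -mulrDl ler_pM2r// natr1 ltW.
apply: (le_trans (le_outer_measure outer _ _ cover)).
apply: (le_trans (outer_measure_big _ _ _)).
apply: (@le_trans _ _ (\sum_(f in family P)
  ((2 * L) ^+ n.+1 * \prod_(i < n.+1) s)%:E)%E).
  by apply: lee_sum => f _; exact: outer_preimage_cube.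
rewrite sumEFin lee_fin -big_distrr /= ler_wpM2l ?exprn_ge0 ?mulr_ge0//.
rewrite -(bigA_distr_big_dep P (fun _ _ => s)).
apply: ler_prod => i _.
rewrite sumr_ge0//= (big_ord_narrow (mM i)) sumr_const card_ord.
rewrite -mulr_natl -natr1 mulrDl mul1r lerD2r -ler_pdivlMr// truncn_le.
by rewrite divr_ge0// subr_ge0.
Qed.

Lemma outer_preimage_box (a b : 'rV[R]_n.+1) :
  (outer (S `&` phi @^-1` box a b) <= ((2 * L) ^+ n.+1 * box_volume a b)%:E)%E.
Proof.
have [ab|] := pselect (forall i, a 0 i <= b 0 i); last first.
  move/existsNP => [i /negP abi]; rewrite (_ : _ `&` _ = set0).
    by rewrite /outer outer_measure0 lee_fin mulr_ge0 ?exprn_ge0 ?mulr_ge0 ?box_volume_ge0.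
  apply/seteqP; split => // z [_ /(_ i) /andP[az zb]].
  by case: abi; rewrite (le_trans az zb).
have -> : box_volume a b = \prod_(i < n.+1) (b 0 i - a 0 i + 0).
  by apply: eq_bigr => i _; rewrite addr0 max_r// subr_ge0.
set C := (2 * L) ^+ n.+1; pose h s := C * \prod_(i < n.+1) (b 0 i - a 0 i + s).
apply/lee_addgt0Pr => e e_gt0; rewrite -EFinD.
have hcont : h @ 0 --> h 0.
  apply: cvgMr; apply: cvg_big => [|i _]; first exact: mul_continuous.
  by apply: cvgD; [exact: cvg_cst|exact: cvg_id].
have h_lt : \forall s \near 0^'+, h s < h 0 + e.
  by apply: cvgr_lt; [exact: cvg_at_right_filter hcont|rewrite ltrDl].
near (0:R)^'+ => s.
have s_gt0 : 0 < s by near: s; exact: nbhs_right_gt.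
apply: (le_trans (outer_preimage_box_le ab s_gt0)).
by rewrite lee_fin ltW//; near: s.
Unshelve. all: by end_near. Qed.

(** Boxes of total volume [v] covering [N] have preimages in [S] of total outer
    measure at most [(2 L)^n v], so the preimage of a null set is null. *)
Lemma outer_preimage_null (N : set 'rV[R]_n.+1) :
  outer N = 0%E -> outer (S `&` phi @^-1` N) = 0%E.
Proof.
move=> N0; set C := (2 * L) ^+ n.+1.
have C_ge0 : 0 <= C by rewrite exprn_ge0 ?mulr_ge0.
apply/eqP; rewrite eq_le lebesgue_outer_ge0 andbT.
apply/lee_addgt0Pr => e e_gt0; rewrite add0e.
have d_gt0 : 0 < e / (C + 1) by rewrite divr_gt0// ltr_wpDl.
have Nfin : outer N \is a fin_num by rewrite N0.
have [_ [c [d [Ncd ->]]]] := lb_ereal_inf_adherent d_gt0 Nfin.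
rewrite -/(lebesgue_outer N) -/outer N0 add0e => vol_lt.
have cover : S `&` phi @^-1` N `<=` \bigcup_k (S `&` phi @^-1` box (c k) (d k)).
  by move=> z [Sz /Ncd [k _ zk]]; exists k.
apply: (le_trans (le_outer_measure outer _ _ cover)).
apply: (le_trans (outer_measure_sigma_subadditive outer _)).
apply: (@le_trans _ _ (\sum_(0 <= k <oo) (C%:E * (box_volume (c k) (d k))%:E))%E).
  apply: lee_nneseries => [k _ _|k _]; first exact: outer_measure_ge0.
  exact: outer_preimage_box.
rewrite nneseriesZl; last by move=> k _; rewrite lee_fin box_volume_ge0.
apply: (le_trans (lee_wpmul2l _ (ltW vol_lt))); first by rewrite lee_fin.
by rewrite -EFinM lee_fin mulrCA ger_pMr// ler_pdivrMr ?mul1r ?ltr_wpDl// lerDl.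
Qed.

End Transport.

(** * Norms, scalar products and half-spaces *)

Lemma dotE (R : realType) (n : nat) (v w : 'rV[R]_n) : dot v w = (v *m w^T) 0 0.
Proof. by rewrite mxE; apply: eq_bigr => i _; rewrite mxE. Qed.

Section DotNorm.
Variables (R : realType) (n : nat).
Implicit Types (v w x y : 'rV[R]_n).

Lemma dotC v w : dot v w = dot w v.
Proof. by apply: eq_bigr => i _; rewrite mulrC. Qed.

Lemma dotDl v w y : dot (v + w) y = dot v y + dot w y.
Proof. by rewrite !dotE mulmxDl mxE. Qed.

Lemma dotNl v y : dot (- v) y = - dot v y.
Proof. by rewrite !dotE mulNmx mxE. Qed.

Lemma dotBl v w y : dot (v - w) y = dot v y - dot w y.
Proof. by rewrite dotDl dotNl. Qed.

Lemma dotZl (k : R) v y : dot (k *: v) y = k * dot v y.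
Proof. by rewrite !dotE -scalemxAl mxE. Qed.

Lemma dot0r v : dot v 0 = 0.
Proof. by rewrite dotE trmx0 mulmx0 mxE. Qed.

Lemma dot_mulmxl m (A : 'M[R]_(m, n)) (v : 'rV[R]_m) w :
  dot (v *m A) w = dot v (w *m A^T).
Proof. by rewrite !dotE trmx_mul trmxK mulmxA. Qed.

Lemma dot_ge0 v : 0 <= dot v v.
Proof. by apply: sumr_ge0 => i _; exact: sqr_ge0. Qed.

Lemma normr_dot_le v w : `|dot v w| <= n%:R * `|v| * `|w|.
Proof.
rewrite (le_trans (ler_norm_sum _ _ _))//.
rewrite (@le_trans _ _ (\sum_(i < n) (`|v| * `|w|)))//.
  by apply: ler_sum => i _; rewrite normrM ler_pM ?coord_le_norm.
by rewrite sumr_const card_ord -mulrA mulr_natl.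
Qed.

Lemma normr_mulmx_le m (v : 'rV[R]_m) (A : 'M[R]_(m, n)) :
  `|v *m A| <= m%:R * `|A| * `|v|.
Proof.
apply: norm_le_coord => [|j]; first by rewrite !mulr_ge0.
rewrite mxE (le_trans (ler_norm_sum _ _ _))//.
rewrite (@le_trans _ _ (\sum_(i < m) (`|A| * `|v|)))//.
  apply: ler_sum => i _; rewrite normrM mulrC ler_pM ?coord_le_norm//.
  by rewrite [leRHS]/Num.Def.normr /= mx_normrE; apply: (le_bigmax _ _ (i, j)).
by rewrite sumr_const card_ord -mulrA mulr_natl.
Qed.

Lemma norm_le_enorm v : `|v| <= enorm v.
Proof.
apply: norm_le_coord => [|i]; first exact: sqrtr_ge0.
rewrite -sqrtr_sqr ler_wsqrtr// expr2 /dot (bigD1 i)//= lerDl.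
by apply: sumr_ge0 => j _; exact: sqr_ge0.
Qed.

Lemma enorm_sqr v : enorm v ^+ 2 = dot v v.
Proof. by rewrite sqr_sqrtr// dot_ge0. Qed.

Lemma enorm_ge0 v : 0 <= enorm v.
Proof. exact: sqrtr_ge0. Qed.

Lemma enorm_le_norm v : enorm v <= n%:R * `|v|.
Proof.
rewrite -(@ler_pXn2r _ 2)// ?nnegrE ?enorm_ge0 ?mulr_ge0//.
rewrite enorm_sqr; apply: le_trans (ler_norm _) (le_trans (normr_dot_le _ _) _).
rewrite -mulrA -expr2 exprMn ler_wpM2r ?sqr_ge0//.
by rewrite -natrX ler_nat; case: (n) => // k; rewrite -mulnn leq_pmulr.
Qed.

Lemma dot_continuous w : continuous (fun v : 'rV[R]_n => dot v w).
Proof.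
have term i : continuous (fun v : 'rV[R]_n => v 0 i * w 0 i).
  by move=> v; apply: continuousM; [exact: coord_continuous|exact: cst_continuous].
by apply: continuous_big => [|i _]; [exact: add_continuous|exact: term].
Qed.

Lemma halfspace_closed w k : closed [set v | dot v w <= k].
Proof.
rewrite (_ : mkset _ = (fun v => dot v w) @^-1` [set r | r <= k])//.
by apply: closed_comp; [move=> v _; exact: dot_continuous|exact: closed_le].
Qed.

Lemma halfspace_convex w k : convex_set [set v | dot v w <= k].
Proof.
apply/convex_setW => v v'; rewrite !inE /= => vk v'k l l0 l1.
apply/mem_set; change (dot (l%:num *: v + (1 - l%:num) *: v') w <= k).
rewrite dotDl !dotZl.
have l'0 : 0 < 1 - l%:num by rewrite subr_gt0.
have := ler_wpM2l (ltW l0) vk; have := ler_wpM2l (ltW l'0) v'k; lra.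
Qed.

Lemma supball_closed M : closed [set v : 'rV[R]_n | `|v| <= M].
Proof.
rewrite (_ : mkset _ = Num.norm @^-1` [set r | r <= M])//.
by apply: closed_comp; [move=> v _; exact: norm_continuous|exact: closed_le].
Qed.

Lemma supball_convex M : convex_set [set v : 'rV[R]_n | `|v| <= M].
Proof.
apply/convex_setW => v v'; rewrite !inE /= => vk v'k l l0 l1.
apply/mem_set; change (`|l%:num *: v + (1 - l%:num) *: v'| <= M).
have l'0 : 0 < 1 - l%:num by rewrite subr_gt0.
rewrite (le_trans (ler_normD _ _))// !normrZ !gtr0_norm//.
have := ler_wpM2l (ltW l0) vk; have := ler_wpM2l (ltW l'0) v'k; lra.
Qed.

Lemma nbhs_eball x (U : set 'rV[R]_n) :
  nbhs x U -> exists2 d : R, 0 < d & eball x d `<=` U.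
Proof.
move=> /nbhs_ballP[d /= d_gt0 dU]; exists d => // y; rewrite /eball/= => yd.
by apply: dU; rewrite -ball_normE /ball_/= distrC (le_lt_trans _ yd)// norm_le_enorm.
Qed.

Lemma eball_nbhs x d : 0 < d -> nbhs x (eball x d).
Proof.
move=> d_gt0; have n_gt0 : 0 < (n.+1)%:R :> R by [].
apply/nbhs_ballP; exists (d / n.+1%:R); first by rewrite /= divr_gt0.
move=> y; rewrite -ball_normE /ball_/= distrC ltr_pdivlMr// => yd.
rewrite /eball/= (le_lt_trans (enorm_le_norm _))// (le_lt_trans _ yd)//.
by rewrite mulrC ler_wpM2l// ler_nat.
Qed.

End DotNorm.

(** * Filippov's map *)

Section Hull.
Variables (R : realType) (n : nat).
Implicit Types (A C : set 'rV[R]_n).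

Lemma closed_convex_hull_sub A C :
  closed C -> convex_set C -> A `<=` C -> closed_convex_hull A `<=` C.
Proof. by move=> Ccl Cco AC; apply: smallest_sub. Qed.

Lemma closed_convex_hull_mono A B :
  A `<=` B -> closed_convex_hull A `<=` closed_convex_hull B.
Proof.
by move=> AB v Av C [CC BC]; apply: Av; split => //; exact: subset_trans AB BC.
Qed.

Lemma sub_closed_convex_hull A : A `<=` closed_convex_hull A.
Proof. exact: sub_gen_smallest. Qed.

Lemma closed_closed_convex_hull A : closed (closed_convex_hull A).
Proof. by rewrite /closed_convex_hull /smallest; apply: closed_bigI => C [[Ccl _] _]. Qed.

Lemma filippovN (X : 'rV[R]_n -> 'rV[R]_n) x v :
  filippov (fun z => - X z) x v -> filippov X x (- v).
Proof.
move=> Fv d d_gt0 N N0 C [[Ccl Cco] XC].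
have := Fv d d_gt0 N N0; rewrite -[C (- v)]/((-%R @^-1` C) v).
apply: closed_convex_hull_sub.
- by apply: closed_comp => // w _; exact: opp_continuous.
- move=> w w' l /set_mem /= Cw /set_mem /= Cw'; apply/mem_set.
  have /set_mem := Cco (- w) (- w') l (mem_set Cw) (mem_set Cw').
  change (C (l%:num *: (- w) + (1 - l%:num) *: (- w')) ->
    C (- (l%:num *: w + (1 - l%:num) *: w'))).
  by rewrite !scalerN -opprD.
- by move=> _ [z zd <-]; rewrite /= opprK; apply: XC; exists z.
Qed.

End Hull.

Section UpperSemicontinuity.
Variables (R : realType) (n : nat).

Lemma null_setU (N1 N2 : set 'rV[R]_n.+1) :
  lebesgue_outer N1 = 0%E -> lebesgue_outer N2 = 0%E ->
  lebesgue_outer (N1 `|` N2) = 0%E.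
Proof.
move=> N10 N20; apply/eqP; rewrite eq_le lebesgue_outer_ge0 andbT.
apply: (le_trans (outer_measureU2 (@lebesgue_outer R n.+1) _ _)).
by rewrite /= N10 N20 adde0.
Qed.

(** Properties holding almost everywhere in some ball around [x]: the filter in
    terms of which Filippov's map is defined. *)
Definition ess_near (x : 'rV[R]_n.+1) : set_system 'rV[R]_n.+1 :=
  filter_from [set dN : R * set 'rV[R]_n.+1 | 0 < dN.1 /\ lebesgue_outer dN.2 = 0%E]
    (fun dN => eball x dN.1 `\` dN.2).

#[global] Instance ess_near_filter x : Filter (ess_near x).
Proof.
apply: filter_from_filter.
  by exists (1, set0); split; rewrite ?lebesgue_outer0//=.
move=> [d1 M1] [d2 M2] [/= d1_gt0 M10] [/= d2_gt0 M20].
exists (Num.min d1 d2, M1 `|` M2).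
  by split; [rewrite /= lt_min d1_gt0|exact: null_setU].
move=> z [/=]; rewrite /eball /= lt_min => /andP[zd1 zd2] Mz.
by split; split => //= Miz; apply: Mz; [left|right].
Qed.

Lemma ess_near_intro x d N (P : set 'rV[R]_n.+1) : 0 < d ->
  lebesgue_outer N = 0%E -> (forall z, eball x d z -> ~ N z -> P z) ->
  ess_near x P.
Proof. by move=> d_gt0 N0 dNP; exists (d, N) => // z [zd Nz]; exact: dNP. Qed.

Lemma nbhs_ess_near x (P : set 'rV[R]_n.+1) : nbhs x P -> ess_near x P.
Proof.
move=> /nbhs_eball[d d_gt0 dP].
by apply: (ess_near_intro d_gt0 (lebesgue_outer0 _ _)) => z /dP.
Qed.

Lemma norm_lt_ess_near x r : 0 < r -> ess_near x [set z | `|z - x| < r].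
Proof.
move=> r_gt0; apply: nbhs_ess_near; apply/nbhs_ballP; exists r => // z.
by rewrite -ball_normE /ball_/= distrC.
Qed.

(** A ball around [x] contains balls around all the points near [x]. *)
Lemma ess_near_near x (P : set 'rV[R]_n.+1) :
  ess_near x P -> \forall z \near x, ess_near z P.
Proof.
move=> [[d N] /= [d_gt0 N0] dNP]; have := eball_nbhs x d_gt0.
move=> /nbhs_interior; apply: filterS => z /nbhs_eball[d' d'_gt0 d'd].
by apply: (ess_near_intro d'_gt0 N0) => w /d'd wd Nw; exact: dNP.
Qed.

Lemma ess_near_bounded (X : 'rV[R]_n.+1 -> 'rV[R]_n.+1) x :
  locally_ess_bounded (@lebesgue_outer R n.+1) setT X ->
  exists M, ess_near x [set z | `|X z| <= M].
Proof.
move=> /(_ x I)[U xU [M]]; rewrite setIT => N0; exists M.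
have [d d_gt0 dU] := nbhs_eball xU.
apply: (ess_near_intro d_gt0 N0) => z /dU Uz Nz.
rewrite /= (le_trans (norm_le_enorm _))// leNgt; apply/negP => Mz.
exact: Nz.
Qed.

Lemma filippov_sub (X : 'rV[R]_n.+1 -> 'rV[R]_n.+1) x (C : set 'rV[R]_n.+1) :
  closed C -> convex_set C -> ess_near x [set z | C (X z)] ->
  filippov X x `<=` C.
Proof.
move=> Ccl Cco [[d N] /= [d_gt0 N0] XC] v /(_ d d_gt0 N N0).
by apply: closed_convex_hull_sub => // _ [z zdN <-]; exact: XC.
Qed.

(** Upper semicontinuity of Filippov's map, in the direction [w]: if [X] took
    values in the opposite half-space on a non-null set in every ball around [y],
    all the closed convex hulls would meet that half-space, and by compactness so
    would their intersection, which is [filippov X y]. *)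
Lemma filippov_halfspace_usc (X : 'rV[R]_n.+1 -> 'rV[R]_n.+1) y w (M c e : R) :
  ess_near y [set z | `|X z| <= M] ->
  (forall eta, filippov X y eta -> c <= dot eta w) -> 0 < e ->
  ess_near y [set z | c - e < dot (X z) w].
Proof.
move=> XM Fc e_gt0; apply: contrapT => bad.
pose H := [set eta : 'rV[R]_n.+1 | dot eta w <= c - e].
pose K (A : set 'rV[R]_n.+1) := closed_convex_hull (X @` A) `&` H.
have K0 A : ess_near y A -> K A !=set0.
  move=> yA; apply: contrapT => Kempty; apply: bad; apply: filterS yA => z Az /=.
  rewrite ltNge; apply/negP => zH; apply: Kempty; exists (X z); split => //.
  by apply: sub_closed_convex_hull; exists z.
have Kfilter : Filter (filter_from (ess_near y) K).
  apply: filter_from_filter; first by exists setT; exact: filterT.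
  move=> A B yA yB; exists (A `&` B); first exact: filterI.
  by move=> eta [Keta Heta]; split; split => //;
    apply: closed_convex_hull_mono Keta; apply: image_subset => z [].
have Kproper := filter_from_proper Kfilter K0.
have Bcompact : compact [set v : 'rV[R]_n.+1 | `|v| <= M].
  apply: bounded_closed_compact; last exact: supball_closed.
  exists M; split; first exact: num_real.
  by move=> M' MM' v /= vM; rewrite (le_trans vM)// ltW.
have KB : filter_from (ess_near y) K [set v | `|v| <= M].
  exists [set z | `|X z| <= M] => // eta [+ _].
  apply: (@closed_convex_hull_sub _ _ _ [set v | `|v| <= M]).
  - exact: supball_closed.
  - exact: supball_convex.
  - by move=> _ [z Xz <-].
have [eta [_ eta_cluster]] := Bcompact _ Kproper KB.
have etaK A : ess_near y A -> K A eta.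
  move=> yA; have : closed (K A).
    by apply: closedI; [exact: closed_closed_convex_hull|exact: halfspace_closed].
  apply => B Beta; apply: (eta_cluster (K A) B _ Beta); exact: in_filter_from.
have etaF : filippov X y eta.
  move=> d d_gt0 N N0; have [] // := etaK (eball y d `\` N).
  by apply: (ess_near_intro d_gt0 N0) => z.
have [_] := etaK _ XM; rewrite /H /= => etaH.
by have := le_trans (Fc _ etaF) etaH; rewrite lerBrDr gerDl leNgt e_gt0.
Qed.

End UpperSemicontinuity.

(** * Strict differentiability and local inversion *)

Definition locally_lipschitz_at (R : realType) (V W : normedModType R) (f : V -> W)
    (p : V) :=
  exists2 r : R, 0 < r & exists2 K : R, 0 < K & forall z z',
    `|z - p| < r -> `|z' - p| < r -> `|f z - f z'| <= K * `|z - z'|.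

Section Calculus.
Variables (R : realType).

Lemma mean_value01 (h dh : R -> R) :
  (forall t : R, is_derive t 1 h (dh t)) ->
  exists2 c, 0 < c < 1 & h 1 - h 0 = dh c.
Proof.
move=> hdh; have hcont : {within `[0, 1], continuous h}.
  apply: continuous_subspaceT => t; apply: differentiable_continuous.
  by apply/derivable1_diffP; have [] := hdh t.
have [c c01 ->] := MVT ltr01 (fun t _ => hdh t) hcont.
by exists c; [move: c01; rewrite in_itv|rewrite subr0 mulr1].
Qed.

Lemma is_derive_comp_jacobian m n (x : R -> 'rV[R]_m) (G : 'rV[R]_m -> 'rV[R]_n)
    (t : R) dx :
  is_derive t 1 x dx -> differentiable G (x t) ->
  is_derive t 1 (G \o x) (dx *m 'J G (x t)).
Proof.
move=> [/derivable1_diffP xt <-] Gx; split.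
  by apply/derivable1_diffP; exact: differentiable_comp.
rewrite !deriveE//; last exact: differentiable_comp.
by rewrite diff_comp//= /jacobian mul_rV_lin1.
Qed.

Lemma is_derive_coord m n (M : R -> 'M[R]_(m, n)) (t : R) dM i j :
  is_derive t 1 M dM -> is_derive t 1 (fun s => M s i j) (dM i j).
Proof.
move=> [Mt <-]; split; first exact: (derivable_mxP _ _ _).1.
by rewrite derive_mx// mxE.
Qed.

Lemma is_derive_line n (z d : 'rV[R]_n) (t : R) :
  is_derive t 1 (fun s => z + s *: d) d.
Proof.
have Dd : is_derive t 1 (fun s : R => s *: d) d.
  split; first by apply/derivable1_diffP.
  by rewrite deriveE// diff_val scale1r.
by apply: is_derive_eq; rewrite add0r.
Qed.

Lemma norm_segment_sub n (x z z' : 'rV[R]_n) (r t : R) :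
  0 < t < 1 -> `|z - x| < r -> `|z' - x| < r ->
  `|z' + t *: (z - z') - x| < r.
Proof.
move=> /andP[t0 t1] zr z'r.
have -> : z' + t *: (z - z') - x = (1 - t) *: (z' - x) + t *: (z - x).
  by apply/rowP => i; rewrite !mxE; ring.
have t'0 : 0 < 1 - t by rewrite subr_gt0.
rewrite (le_lt_trans (ler_normD _ _))// !normrZ !gtr0_norm//.
have := ltr_pM2l t0 `|z - x| r; have := ltr_pM2l t'0 `|z' - x| r.
rewrite zr z'r; lra.
Qed.

Section StrictDifferentiability.
Variables (m n : nat) (G : 'rV[R]_m -> 'rV[R]_n).
Hypotheses (Gdiff : forall x, differentiable G x).
Variable x : 'rV[R]_m.
Hypothesis (JGcont : {for x, continuous (jacobian G)}).

Lemma jacobian_near (e : R) : 0 < e ->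
  exists2 r, 0 < r & forall z, `|z - x| < r -> `|'J G z - 'J G x| <= e.
Proof.
move=> e_gt0.
move/cvgrPdist_le : JGcont => /(_ _ e_gt0) /nbhs_ballP[r r_gt0 rG].
exists r => // z zr; rewrite distrC; apply: rG.
by rewrite -ball_normE /ball_/= distrC.
Qed.

(** The Jacobian being continuous, [G] differs from its linearisation at [x] by
    a map whose Lipschitz constant is arbitrarily small near [x]. *)
Lemma strictly_differentiable (e : R) : 0 < e ->
  exists2 r, 0 < r & forall z z', `|z - x| < r -> `|z' - x| < r ->
    `|G z - G z' - (z - z') *m 'J G x| <= e * `|z - z'|.
Proof.
move=> e_gt0; have m_gt0 : 0 < m.+1%:R :> R by [].
have [r r_gt0 Jr] := jacobian_near (divr_gt0 e_gt0 m_gt0).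
exists r => // z z' zr z'r.
apply: norm_le_coord => [|j]; first by rewrite mulr_ge0// ltW.
set d := z - z'.
pose h t := G (z' + t *: d) 0 j - t * (d *m 'J G x) 0 j.
pose dh t := (d *m 'J G (z' + t *: d)) 0 j - (d *m 'J G x) 0 j.
have hdh (t : R) : is_derive t 1 h (dh t).
  have D1 : is_derive t 1 (fun s : R => G (z' + s *: d) 0 j)
      ((d *m 'J G (z' + t *: d)) 0 j).
    exact: is_derive_coord (is_derive_comp_jacobian (is_derive_line z' d t) (Gdiff _)).
  have D2 : is_derive t 1 (fun s : R => s * (d *m 'J G x) 0 j) ((d *m 'J G x) 0 j).
    by apply: is_derive_eq; rewrite scaler0 add0r [LHS]mulr1.
  exact: (is_deriveB D1 D2).
have [c c01] := mean_value01 hdh.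
rewrite /h scale1r scale0r addr0 mul1r mul0r subr0 [z' + d]addrC subrK => hc.
have -> : (G z - G z' - (z - z') *m 'J G x) 0 j = dh c.
  by rewrite -hc !mxE; ring.
have -> : dh c = (d *m ('J G (z' + c *: d) - 'J G x)) 0 j.
  by rewrite mulmxBr [RHS]mxE [X in _ + X]mxE.
rewrite (le_trans (coord_le_norm _ _))// (le_trans (normr_mulmx_le _ _))//.
rewrite ler_wpM2r//.
have JJ : `|'J G (z' + c *: d) - 'J G x| <= e / m.+1%:R.
  by apply: Jr; exact: norm_segment_sub.
rewrite (le_trans (ler_wpM2l _ JJ))// mulrCA ger_pMr// ler_pdivrMr// mul1r.
by rewrite ler_nat.
Qed.

End StrictDifferentiability.

Lemma posdef_unitmx n (A : 'M[R]_n) : posdef A -> A \in unitmx.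
Proof.
move=> Apos; rewrite -row_free_unit; apply: inj_row_free => v vA.
apply/eqP/negP => /negP /Apos.
by rewrite vA dotC dot0r ltxx.
Qed.

Lemma unitmx_expands n (A : 'M[R]_n) : A \in unitmx ->
  exists2 K, 0 < K & forall v : 'rV[R]_n, `|v| <= K * `|v *m A|.
Proof.
move=> Aunit; exists (n%:R * `|invmx A| + 1) => [|v].
  by rewrite ltr_wpDl// mulr_ge0.
rewrite -{1}[v](mulmxK Aunit) (le_trans (normr_mulmx_le _ _))//.
by rewrite ler_wpM2r// lerDl.
Qed.

Section LocalInverse.
Variables (n : nat) (G : 'rV[R]_n -> 'rV[R]_n).
Hypotheses (Gdiff : forall x, differentiable G x).
Variable x : 'rV[R]_n.
Hypotheses (JGcont : {for x, continuous (jacobian G)})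
  (JGunit : 'J G x \in unitmx).

Lemma locally_lipschitz_C1 : locally_lipschitz_at G x.
Proof.
have [r r_gt0 rG] := strictly_differentiable Gdiff JGcont ltr01.
exists r => //; exists (n%:R * `|'J G x| + 1); first by rewrite ltr_wpDl// mulr_ge0.
move=> z z' zr z'r; have := rG _ _ zr z'r; rewrite mul1r => GJ.
rewrite -[G z - G z'](subrK ((z - z') *m 'J G x)) (le_trans (ler_normD _ _))//.
by rewrite mulrDl mul1r addrC lerD// normr_mulmx_le.
Qed.

(** The quantitative half of the inverse function theorem: injectivity of [G]
    near [x] with a Lipschitz inverse, without surjectivity. *)
Lemma locally_expanding :
  exists2 r, 0 < r & exists2 K, 0 < K & forall z z',
    `|z - x| < r -> `|z' - x| < r -> `|z - z'| <= K * `|G z - G z'|.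
Proof.
have [K K_gt0 KA] := unitmx_expands JGunit.
have [r r_gt0 rG] := strictly_differentiable Gdiff JGcont
  (divr_gt0 ltr01 (mulr_gt0 (ltr0Sn _ 1) K_gt0)).
exists r => //; exists (2 * K); first by rewrite mulr_gt0.
move=> z z' zr z'r; have GJ := rG _ _ zr z'r.
set d := z - z' in GJ *; set D := G z - G z' in GJ *.
have dJ : `|d *m 'J G x| <= `|D| + 1 / (2 * K) * `|d|.
  rewrite -[d *m _](subKr D) (le_trans (ler_normB _ _))//.
  by rewrite lerD2l.
have := le_trans (KA d) (ler_wpM2l (ltW K_gt0) dJ).
have -> : K * (`|D| + 1 / (2 * K) * `|d|) = K * `|D| + `|d| / 2.
  by field; rewrite gt_eqF.
lra.
Qed.

Lemma jacobian_expands_near :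
  exists2 r, 0 < r & exists2 K, 0 < K & forall z (v : 'rV[R]_n),
    `|z - x| < r -> `|v| <= K * `|v *m 'J G z|.
Proof.
have [K K_gt0 KA] := unitmx_expands JGunit.
have n_gt0 : 0 < n.+1%:R :> R by [].
have e_gt0 : 0 < 1 / (2 * K * n.+1%:R) by rewrite divr_gt0// !mulr_gt0.
have [r r_gt0 rG] := jacobian_near JGcont e_gt0.
exists r => //; exists (2 * K); first by rewrite mulr_gt0.
move=> z v zr; have GJ := rG _ zr.
have vB : `|v *m ('J G z - 'J G x)| <= `|v| / (2 * K).
  rewrite (le_trans (normr_mulmx_le _ _))// mulrC ler_wpM2l//.
  rewrite (le_trans (ler_wpM2l _ GJ))//.
  rewrite (@le_trans _ _ (n.+1%:R * (1 / (2 * K * n.+1%:R))))//.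
    by rewrite ler_wpM2r ?ler_nat// ltW.
  by rewrite le_eqVlt; apply/orP; left; apply/eqP; field; rewrite !gt_eqF.
move: KA vB; move: ('J G x) ('J G z) => A B KA vB.
have vA : v *m B - v *m (B - A) = v *m A by rewrite mulmxBr opprB addrC subrK.
have := ler_normB (v *m B) (v *m (B - A)); rewrite vA => /le_trans vAle.
have := le_trans (KA v) (ler_wpM2l (ltW K_gt0) (vAle _ (lerD (lexx _) vB))).
have -> : K * (`|v *m B| + `|v| / (2 * K)) = K * `|v *m B| + `|v| / 2.
  by field; rewrite gt_eqF.
lra.
Qed.

End LocalInverse.
End Calculus.

(** * The feedback in gradient coordinates *)

Lemma mulNmx_split (R : realType) n (v : 'rV[R]_n) (A B : 'M[R]_n) :
  - v *m A = v *m (B - A) - v *m B.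
Proof. by rewrite mulmxBr mulNmx addrAC subrr sub0r. Qed.

Section Feedback.
Variables (R : realType) (n : nat).
Variables (G : 'rV[R]_n.+1 -> 'rV[R]_n.+1).
Hypotheses (Gdiff : forall x, differentiable G x)
  (JGcont : continuous (jacobian G)) (JGunit : forall x, 'J G x \in unitmx).
Variable x : 'rV[R]_n.+1.

(** Continuity of [G] takes balls around [x] into balls around [G x], and its
    Lipschitz left inverse takes null sets back to null sets. *)
Lemma ess_near_preimage P : ess_near (G x) P -> ess_near x (G @^-1` P).
Proof.
move=> [[d N] /= [d_gt0 N0] dNP].
have [r r_gt0 [K K_gt0 Gexp]] := locally_expanding Gdiff (@JGcont x) (JGunit x).
pose S := [set z | `|z - x| < r].
have GN0 : lebesgue_outer (S `&` G @^-1` N) = 0%E.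
  apply: (@outer_preimage_null R n G S K (ltW K_gt0) _ N N0) => z z'.
  exact: Gexp.
have S_near : ess_near x S := norm_lt_ess_near x r_gt0.
have G_near : ess_near x (G @^-1` eball (G x) d).
  apply: nbhs_ess_near; apply: (differentiable_continuous (Gdiff x)).
  exact: eball_nbhs.
have N_near : ess_near x (~` (S `&` G @^-1` N)).
  by apply: (ess_near_intro ltr01 GN0).
move: S_near G_near N_near; apply: filterS3 => z Sz Gz NGz.
by apply: dNP; split => // Nz; apply: NGz.
Qed.

Variable g : 'rV[R]_n.+1 -> 'rV[R]_n.+1.
Let u z := g (G z) *m invmx ('J G z).

Lemma feedback_mul_jacobian z : u z *m 'J G z = g (G z).
Proof. by rewrite /u mulmxKV. Qed.

Lemma feedback_ess_bounded M :
  ess_near (G x) [set y | `|g y| <= M] -> exists M', ess_near x [set z | `|u z| <= M'].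
Proof.
move=> /ess_near_preimage gM.
have [r r_gt0 [K K_gt0 JGexp]] := jacobian_expands_near (@JGcont x) (JGunit x).
exists (K * M); move: gM (norm_lt_ess_near x r_gt0).
apply: filterS2 => z /= gM zr; rewrite (le_trans (JGexp _ _ zr))//.
by rewrite feedback_mul_jacobian ler_wpM2l// ltW.
Qed.

(** The Hessian at the centre [x] may be replaced by the Hessian at the point [z]
    where the field is evaluated: [u] is bounded and the Hessian is continuous, so
    [u z *m 'J G x] is close to [g (G z)]. *)
Lemma feedback_filippov_dot (w : 'rV[R]_n.+1) (c M : R) :
  ess_near (G x) [set y | `|g y| <= M] ->
  (forall e, 0 < e -> ess_near (G x) [set y | c - e < dot (g y) w]) ->
  forall v, filippov (fun z => - u z) x v -> dot (v *m 'J G x) w <= - c.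
Proof.
move=> gM gc v Fv; apply/ler_addgt0Pr => e e_gt0; rewrite dot_mulmxl.
have [M' uM'] := feedback_ess_bounded gM.
pose B := n.+1%:R * (n.+1%:R * `|M'|) * `|w| + 1.
have B_gt0 : 0 < B by rewrite ltr_wpDl// !mulr_ge0.
have e2_gt0 : 0 < e / 2 by rewrite divr_gt0.
have [r r_gt0 Jr] := jacobian_near (@JGcont x) (divr_gt0 e2_gt0 B_gt0).
apply: (filippov_sub (C := [set v | dot v (w *m ('J G x)^T) <= - c + e]) _ _ _ Fv).
- exact: halfspace_closed.
- exact: halfspace_convex.
move: (ess_near_preimage (gc _ e2_gt0)) uM' (norm_lt_ess_near x r_gt0).
apply: filterS3 => z /= gz uz /Jr Jz; rewrite -dot_mulmxl.
have -> : - u z *m 'J G x = u z *m ('J G z - 'J G x) - g (G z).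
  by rewrite (mulNmx_split _ _ ('J G z)); congr (_ - _); exact: feedback_mul_jacobian.
rewrite dotBl.
have : dot (u z *m ('J G z - 'J G x)) w <= e / 2.
  rewrite (le_trans (ler_norm _))// (le_trans (normr_dot_le _ _))//.
  rewrite (@le_trans _ _ (n.+1%:R * (n.+1%:R * (e / 2 / B) * `|M'|) * `|w|))//.
    rewrite ler_wpM2r// ler_wpM2l// (le_trans (normr_mulmx_le _ _))//.
    by rewrite ler_pM ?mulr_ge0 ?ler_wpM2l// (le_trans uz)// ler_norm.
  have -> : n.+1%:R * (n.+1%:R * (e / 2 / B) * `|M'|) * `|w| = (B - 1) * (e / 2 / B).
    by rewrite /B addrK; ring.
  by rewrite mulrCA ger_pMr// ler_pdivrMr// mul1r gerBl.
lra.
Qed.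

Lemma feedback_filippov_bounded M :
  ess_near (G x) [set y | `|g y| <= M] ->
  exists M', \forall z \near x, forall v, filippov u z v -> `|v| <= M'.
Proof.
move=> /feedback_ess_bounded[M' /ess_near_near uM']; exists M'.
apply: filterS uM' => z uM' v; apply: (filippov_sub (C := [set v | `|v| <= M'])) => //.
- exact: supball_closed.
- exact: supball_convex.
Qed.

End Feedback.

(** * Absolutely continuous functions *)

Section AbsoluteContinuity.
Variable R : realType.
Implicit Types (a b c k : R) (w : R -> R).

(** Induction along a segment: the induction step has to work across each point
    [c], which covers at once the passage to the limit and the propagation to
    the right of [c]. *)
Lemma segment_induction a b (S : set R) : a <= b -> S a ->
  (forall c, a <= c <= b -> exists2 r, 0 < r & forall t s,
     a <= t -> t <= c -> c <= s -> s <= b -> c - r < t -> s < c + r ->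
     S t -> S s) ->
  S b.
Proof.
move=> ab Sa step; pose E := [set t | a <= t <= b /\ S t].
have Ea : E a by split => //; rewrite lexx.
have Esup : has_sup E.
  by split; [exists a|exists b => t [/andP[]]].
have Ele t : E t -> t <= sup E by exact: sup_upper_bound.
have cab : a <= sup E <= b.
  by rewrite (Ele _ Ea) ge_sup//; [exists a|move=> t [/andP[]]].
have [r r_gt0 Sr] := step _ cab; have [t Et tr] := sup_adherent r_gt0 Esup.
have [/andP[at_ tb] St] := Et.
have /andP[ac cb] := cab.
have [cltb|bc] := ltP (sup E) b; last first.
  by apply: (Sr t) => //; [exact: Ele|rewrite (le_lt_trans bc)// ltrDl].
pose s := Num.min b (sup E + r / 2).
have cs : sup E < s by rewrite lt_min cltb ltrDl divr_gt0.
have Es : E s.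
  split; first by rewrite ge_min lexx (le_trans ac)//= ltW.
  apply: (Sr t) => //; first exact: Ele.
  - exact: ltW.
  - by rewrite ge_min lexx.
  - by rewrite gt_min ltrD2l gtr_pMr// orbC invf_lt1// ltr1n.
by move: (Ele _ Es); rewrite leNgt cs.
Qed.

Definition real_abs_continuous a b w :=
  forall e : R, 0 < e -> exists2 d : R, 0 < d &
    forall (m : nat) (s t : 'I_m -> R),
      (forall i, [/\ a <= s i, s i <= t i & t i <= b]) ->
      trivIset [set: 'I_m] (fun i => `]s i, t i[%classic) ->
      \sum_(i < m) (t i - s i) < d ->
      \sum_(i < m) `|w (t i) - w (s i)| < e.

Lemma derivable_increment_le w c k e : derivable w c 1 -> w^`()%classic c <= k ->
  0 < e -> exists2 r, 0 < r & forall t s, t <= c -> c <= s -> c - r < t ->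
    s < c + r -> w s - w t <= (k + e) * (s - t).
Proof.
move=> wc wk e_gt0; have := wc; rewrite /derivable => /cvgrPdist_lt /(_ _ e_gt0).
rewrite -[lim _]/('D_1 w c) -derive1E.
move=> /nbhs_ballP[r r_gt0 wr]; exists r => // t s tc cs tr sr.
have quotient h : h != 0 -> `|h| < r -> h^-1 * (w (c + h) - w c) < k + e.
  move=> h0 hr; have /(_ h) := wr; rewrite -ball_normE /ball_/= sub0r normrN.
  move=> /(_ hr h0); rewrite [h%:A]mulr1 [h + c]addrC -[_ *: _]/(h^-1 * _).
  rewrite distrC => /ltr_distlDr /lt_le_trans; apply; rewrite lerD2r//.
have right : w s - w c <= (k + e) * (s - c).
  have [->|sc] := eqVneq s c; first by rewrite !subrr mulr0.
  have sc_gt0 : 0 < s - c by rewrite subr_gt0 lt_neqAle eq_sym sc.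
  have := quotient (s - c); rewrite subr_eq0 sc gtr0_norm// ltrBlDl sr => /(_ isT isT).
  by rewrite [c + _]addrC subrK => /ltW; rewrite mulrC ler_pdivrMr.
have left : w c - w t <= (k + e) * (c - t).
  have [->|tc'] := eqVneq t c; first by rewrite !subrr mulr0.
  have tc_lt0 : t - c < 0 by rewrite subr_lt0 lt_neqAle tc'.
  have := quotient (t - c); rewrite subr_eq0 tc' ltr0_norm// opprB ltrBlDl -ltrBlDr tr.
  move=> /(_ isT isT).
  rewrite [c + _]addrC subrK -[_ * _]mulrNN -invrN !opprB => /ltW.
  by rewrite mulrC ler_pdivrMr ?subr_gt0// lt_neqAle tc'.
by rewrite -[w s - w t](subrKA (w c)) -[s - t](subrKA c) mulrDr lerD.
Qed.

Lemma sum_interval_lengths_le (m : nat) (s t : 'I_m -> R) (O : set R) :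
  open O -> (forall i, s i <= t i) ->
  trivIset [set: 'I_m] (fun i => `]s i, t i[%classic) ->
  (forall i, `]s i, t i[%classic `<=` O) ->
  ((\sum_(i < m) (t i - s i))%:E <= @lebesgue_measure R O)%E.
Proof.
move=> oO st tr stO.
have mI i : measurable (`]s i, t i[%classic : set R) by exact: measurable_itv.
have -> : ((\sum_(i < m) (t i - s i))%:E =
    lebesgue_measure (\big[setU/set0]_(i < m) `]s i, t i[%classic))%E.
  rewrite measure_bigsetU_ord// -sumEFin; apply: eq_bigr => i _.
  rewrite [RHS](lebesgue_measure_itv `]s i, t i[)/= lte_fin; case: ltP => // ts.
  by rewrite (@le_anti _ _ (t i) (s i)) ?subrr// ts st.
apply: le_measure; rewrite ?inE.
- exact: bigsetU_measurable.
- exact: measurable_realfun.open_measurable.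
- by apply: (big_ind (fun A => A `<=` O)) => // A B AO BO; rewrite subUset.
Qed.

(** An elementary proof by induction along the segment, with no covering theorem.
    The exceptional null set [A] is covered by an open set [O] of small measure;
    across a point of [A] the increment of [w] is stored in a list of intervals
    contained in [O], and across any other point it is bounded by the derivative.
    The stored increments sum up to little, by absolute continuity. *)
Lemma abs_continuous_derive_le a b k w : a <= b -> real_abs_continuous a b w ->
  {ae @lebesgue_measure R, forall t : R, a <= t <= b ->
    derivable w t 1 /\ w^`()%classic t <= k} ->
  w b - w a <= k * (b - a).
Proof.
move=> ab wac [A [mA A0 NA]]; apply/ler_addgt0Pr => e0 e0_gt0.
have ba2_gt0 : 0 < b - a + 2 by rewrite ltr_wpDl// subr_ge0.
pose e := e0 / (b - a + 2); have e_gt0 : 0 < e by rewrite divr_gt0.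
have [d1 d1_gt0 wd] := wac _ e_gt0.
have k1_gt0 : 0 < `|k| + 1 by rewrite ltr_wpDl.
pose d := Num.min d1 (e / (`|k| + 1)).
have d_gt0 : 0 < d by rewrite lt_min d1_gt0 divr_gt0.
have Afin : (lebesgue_measure A < +oo)%E by rewrite [X in (X < _)%E]A0.
have [ O [oO AO Od]] := lebesgue_regularity_outer mA Afin d_gt0.
have O_lt : (lebesgue_measure O < d%:E)%E.
  rewrite -(setDUK AO) (le_lt_trans (measureU2 _ _ _))//.
  - by apply: measurableD => //; exact: measurable_realfun.open_measurable.
  - by rewrite [X in (X + _)%E]A0 add0e.
pose stored (T : R) (m : nat) (s t : nat -> R) :=
  [/\ forall i, (i < m)%N -> [/\ a <= s i, s i <= t i & t i <= T],
      forall i j, (i < j < m)%N -> t i <= s j &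
      forall i, (i < m)%N -> `]s i, t i[%classic `<=` O].
(* The lengths, weighted by [|k|], compensate for a negative [k] on the stored
   intervals. *)
pose S := [set T | exists m s t, stored T m s t /\
  w T - w a <= (k + e) * (T - a) +
    \sum_(i < m) (`|w (t i) - w (s i)| + `|k| * (t i - s i))].
have Sa : S a.
  exists 0%N, (fun=> 0), (fun=> 0); split; first by split => // i j /andP[].
  by rewrite big_ord0 addr0 !subrr mulr0.
have Sstep c : a <= c <= b -> exists2 r, 0 < r & forall t s,
    a <= t -> t <= c -> c <= s -> s <= b -> c - r < t -> s < c + r -> S t -> S s.
  move=> cab; have [Ac|Ac] := pselect (A c).
    have /nbhs_ballP[r r_gt0 rO] : nbhs c O.
      by apply: open_nbhs_nbhs; split => //; exact: AO.
    exists r => // t s at_ tc cs sb tr sr [m [s0 [t0 [[bd ord inO] wt]]]].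
    have ts := le_trans tc cs.
    exists m.+1, (fun i => if (i < m)%N then s0 i else t),
      (fun i => if (i < m)%N then t0 i else s); split; first split.
    - move=> i im; case: ifPn => [/bd[? ? t0t]|_]; last by [].
      by split => //; exact: le_trans t0t ts.
    - move=> i j /andP[ij jm]; have im : (i < m)%N by rewrite (leq_trans ij).
      rewrite im; case: ifPn => jm'; first by apply: ord; rewrite ij.
      by have [] := bd _ im.
    - move=> i im; case: ifPn => [/inO//|_] y /=.
      rewrite in_itv/= => /andP[ty ys]; apply: rO.
      rewrite -ball_normE /ball_/= distrC ltr_norml; apply/andP; split; lra.
    - rewrite big_ord_recr/= ltnn.
      under eq_bigr do rewrite ltn_ord.
      have wst := ler_norm (w s - w t).
      have kst : 0 <= (k + `|k|) * (s - t).
        by rewrite mulr_ge0// ?subr_ge0// -lerBlDl sub0r -normrN ler_norm.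
      have est : 0 <= e * (s - t) by rewrite mulr_ge0 ?subr_ge0// ltW.
      move: wt; set sum0 := \sum_(i < m) _ => wt; nra.
  have [wc wk] : derivable w c 1 /\ w^`()%classic c <= k.
    by apply: contrapT => Hc; apply: Ac; apply: NA => /(_ cab).
  have [r r_gt0 wr] := derivable_increment_le wc wk e_gt0.
  exists r => // t s at_ tc cs sb tr sr [m [s0 [t0 [[bd ord inO] wt]]]].
  exists m, s0, t0; split.
    split => // i /bd[? ? t0t]; split => //; exact: le_trans t0t (le_trans tc cs).
  have := wr _ _ tc cs tr sr; lra.
have [m [s [t [[bd ord inO] wb]]]] := segment_induction ab Sa Sstep.
have trI : trivIset [set: 'I_m] (fun i : 'I_m => `]s i, t i[%classic).
  move=> i j _ _ [y [/=]]; rewrite !in_itv/= => /andP[siy yti] /andP[sjy ytj].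
  have disj (i0 j0 : 'I_m) : (i0 < j0)%N -> s j0 < y -> y < t i0 -> False.
    move=> ij sy yt; have := ord i0 j0 (introT andP (conj ij (ltn_ord j0))).
    by rewrite leNgt (lt_trans sy yt).
  apply/val_inj; case: (ltngtP i j) => // ij; first by case: (disj i j).
  by case: (disj j i).
have lt_d : \sum_(i < m) (t i - s i) < d.
  rewrite -lte_fin (le_lt_trans _ O_lt)//; apply: sum_interval_lengths_le => // i.
    by have [] := bd i (ltn_ord i).
  by apply: inO; exact: ltn_ord.
move: (lt_d); rewrite lt_min => /andP[lt_d1 lt_k].
have := wd m (fun i => s i) (fun i => t i) (fun i => bd i (ltn_ord i)) trI lt_d1.
have : `|k| * (\sum_(i < m) (t i - s i)) <= e.
  rewrite (le_trans (ler_wpM2l (normr_ge0 k) (ltW lt_k)))// mulrCA ger_pMr//.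
  by rewrite ler_pdivrMr// mul1r lerDl.
move: wb; rewrite big_split/= -mulr_sumr.
have : e * (b - a) + e + e = e0.
  by rewrite -addrA -mulr2n -mulr_natr -mulrDr divfK// gt_eqF.
lra.
Qed.

End AbsoluteContinuity.

(** * Locally Lipschitz functions along a curve *)

Section LocallyLipschitz.
Variable R : realType.

Lemma locally_lipschitz_comp (U V W : normedModType R) (f : U -> V) (h : V -> W) p :
  locally_lipschitz_at f p -> locally_lipschitz_at h (f p) ->
  locally_lipschitz_at (h \o f) p.
Proof.
move=> [r r0 [K K0 fK]] [r' r'0 [K' K'0 hK']].
exists (Num.min r (r' / K)); first by rewrite lt_min r0 divr_gt0.
exists (K' * K) => [|z z']; first exact: mulr_gt0.
have pr : `|p - p| < r by rewrite subrr normr0.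
have fp y : `|y - p| < r -> `|y - p| < r' / K -> `|f y - f p| < r'.
  move=> yr yr'; rewrite (le_lt_trans (fK _ _ yr pr))//.
  by rewrite mulrC -ltr_pdivlMr.
rewrite !lt_min => /andP[zr zr'] /andP[z'r z'r'] /=.
rewrite (le_trans (hK' _ _ (fp _ zr zr') (fp _ z'r z'r')))// -mulrA.
by rewrite ler_wpM2l ?fK// ltW.
Qed.

Lemma locally_lipschitz_dot_self n (p : 'rV[R]_n) :
  locally_lipschitz_at (fun y : 'rV[R]_n => dot y y : R) p.
Proof.
exists 1 => //; exists (n%:R * (2 * `|p| + 2) + 1).
  by rewrite ltr_wpDl// mulr_ge0// addr_ge0// mulr_ge0.
move=> z z' zp z'p.
have -> : dot z z - dot z' z' = dot (z - z') (z + z').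
  by rewrite dotBl !(dotC _ (z + z')) !dotDl (dotC z' z); ring.
rewrite (le_trans (normr_dot_le _ _))// [leRHS]mulrC.
have near y : `|y - p| < 1 -> `|y| <= `|p| + 1.
  by move=> yp; rewrite -[y](subrK p) (le_trans (ler_normD _ _))// addrC lerD2l ltW.
have zz' : `|z + z'| <= 2 * `|p| + 2.
  rewrite (le_trans (ler_normD _ _))//; have := near _ zp; have := near _ z'p; lra.
rewrite -mulrA mulrCA ler_wpM2l// (le_trans (ler_wpM2l _ zz'))//.
by rewrite lerDl.
Qed.

Lemma locally_lipschitz_powR (al e0 : R) : 0 < e0 ->
  locally_lipschitz_at (fun e : R => e `^ al : R) e0.
Proof.
move=> e0_gt0; pose dh e := al * e `^ (al - 1).
have dh_cont : {for e0, continuous dh}.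
  apply: differentiable_continuous; apply/derivable1_diffP.
  apply: derivableM => //; have := is_derive1_powR (al - 1) e0_gt0.
  by case.
have /cvgrPdist_lt /(_ 1 ltr01) /nbhs_ballP[r r_gt0 rdh] := dh_cont.
exists (Num.min r e0); first by rewrite lt_min r_gt0.
exists (`|dh e0| + 1) => [|z z']; first by rewrite ltr_wpDl.
rewrite !lt_min => /andP[zr ze] /andP[z'r z'e].
wlog zz' : z z' zr ze z'r z'e / z <= z'.
  move=> wl; have [|/ltW] := leP z z'; first exact: wl.
  by rewrite distrC [X in _ <= _ * X]distrC; apply: wl.
have between c : z <= c <= z' -> `|c - e0| < r /\ 0 < c.
  move: zr ze z'r z'e; rewrite !ltr_distl => ? ? ? ? /andP[? ?].
  split; last lra.
  by apply/andP; split; lra.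
have hder c : z <= c <= z' -> is_derive c 1 (fun e : R => e `^ al) (dh c).
  by move=> /between[_ c_gt0]; exact: is_derive1_powR.
have [||c czz' E] := @MVT_segment R (fun e => e `^ al) dh z z' zz'.
- move=> c; rewrite in_itv/= => /andP[zc cz']; apply: hder.
  by rewrite !ltW.
- apply: derivable_within_continuous => c; rewrite in_itv/= => /hder.
  by case.
rewrite distrC E normrM [`|z - z'|]distrC ler_wpM2r//.
have [cr _] := between c czz'.
have := rdh c; rewrite -ball_normE /ball_/= distrC => /(_ cr) /ltW.
rewrite distrC => ?.
by rewrite -[dh c](subrK (dh e0)) (le_trans (ler_normD _ _))// addrC lerD2l.
Qed.

End LocallyLipschitz.

Section AlongCurve.
Variables (R : realType) (n : nat).
Implicit Types (x : R -> 'rV[R]_n) (a b : R).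

Lemma abs_continuous_on_sub x a b a' b' : a <= a' -> b' <= b ->
  abs_continuous_on a b x -> abs_continuous_on a' b' x.
Proof.
move=> aa' bb' xac e /xac[d d_gt0 xd]; exists d => // m s t st.
by apply: xd => i; have [? ? ?] := st i; split => //;
  [exact: le_trans aa' _|exact: le_trans bb'].
Qed.

Lemma abs_continuous_on_cvg x a b c e : abs_continuous_on a b x ->
  a <= c <= b -> 0 < e ->
  exists2 r, 0 < r & forall s, a <= s <= b -> `|s - c| < r -> `|x s - x c| < e.
Proof.
move=> xac /andP[ac cb] /xac[d d_gt0 xd]; exists d => // s /andP[as_ sb] sc.
have pair (t1 t2 : R) : a <= t1 -> t1 <= t2 -> t2 <= b -> t2 - t1 < d ->
    `|x t2 - x t1| < e.
  move=> at1 t12 t2b td; rewrite (le_lt_trans (norm_le_enorm _))//.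
  have := xd 1%N (fun=> t1) (fun=> t2); rewrite !big_ord1; apply => //.
  by move=> i j _ _ _; rewrite !ord1.
have [cs|sc'] := leP c s.
  by apply: pair => //; rewrite -(ger0_norm (_ : 0 <= s - c)) ?subr_ge0.
rewrite distrC; apply: pair => //; first exact: ltW.
by rewrite -(gtr0_norm (_ : 0 < c - s)) ?subr_gt0// distrC.
Qed.

Lemma real_abs_continuous_dominated x (w : R -> R) a b K : 0 < K ->
  abs_continuous_on a b x ->
  (forall t s, a <= t <= b -> a <= s <= b -> `|w t - w s| <= K * `|x t - x s|) ->
  real_abs_continuous a b w.
Proof.
move=> K_gt0 xac wK e e_gt0; have [d d_gt0 xd] := xac _ (divr_gt0 e_gt0 K_gt0).
exists d => // m s t st tr lt_d; have := xd m s t st tr lt_d.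
rewrite ltr_pdivlMr//; apply: le_lt_trans; rewrite mulr_suml.
apply: ler_sum => i _; have [asi siti tib] := st i.
rewrite (le_trans (wK _ _ _ _)) ?(le_trans asi siti) ?asi ?(le_trans siti tib)//.
by rewrite mulrC ler_wpM2r ?norm_le_enorm// ltW.
Qed.

Lemma ae_lebesgueS (P Q : set R) : P `<=` Q ->
  {ae @lebesgue_measure R, forall t, P t} -> {ae @lebesgue_measure R, forall t, Q t}.
Proof. by move=> PQ; apply: negligibleS; apply: subsetC. Qed.

(** Locally Lipschitz maps need not be Lipschitz on the whole curve, so the
    estimate is proved near each time and glued by induction on the segment. *)
Lemma abs_continuous_comp_derive_le x (Psi : 'rV[R]_n -> R) a b k : a <= b ->
  abs_continuous_on a b x ->
  (forall t, a <= t <= b -> locally_lipschitz_at Psi (x t)) ->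
  {ae @lebesgue_measure R, forall t : R, a <= t <= b ->
    derivable (Psi \o x) t 1 /\ (Psi \o x)^`()%classic t <= k} ->
  Psi (x b) - Psi (x a) <= k * (b - a).
Proof.
move=> ab xac Plip xae.
pose S := [set T | Psi (x T) - Psi (x a) <= k * (T - a)].
suff : S b by [].
apply: (segment_induction ab); first by rewrite /S /= !subrr mulr0.
move=> c cab; have [r r_gt0 [K K_gt0 PK]] := Plip c cab.
have [r' r'_gt0 xr'] := abs_continuous_on_cvg xac cab r_gt0.
exists r' => // t s at_ tc cs sb tr sr.
have ts := le_trans tc cs.
have inab y : t <= y <= s -> a <= y <= b.
  by move=> /andP[ty ys]; rewrite (le_trans at_ ty) (le_trans ys sb).
have near y : t <= y <= s -> `|x y - x c| < r.
  move=> /[dup] /inab yab /andP[ty ys]; apply: xr' => //.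
  by rewrite ltr_distl; apply/andP; split; lra.
have := @abs_continuous_derive_le _ t s k (Psi \o x) ts.
rewrite /S /= => H St.
suff : Psi (x s) - Psi (x t) <= k * (s - t) by move: St; rewrite !mulrBr; lra.
apply: H.
- apply: (real_abs_continuous_dominated K_gt0 (abs_continuous_on_sub at_ sb xac)).
  by move=> y y' yts y'ts; apply: PK; exact: near.
- by apply: ae_lebesgueS xae => y yae yts; apply: yae; exact: inab.
Qed.

Lemma is_derive_dot_self (y : R -> 'rV[R]_n) (t : R) dy : is_derive t 1 y dy ->
  is_derive t 1 (fun s => dot (y s) (y s)) (2 * dot dy (y t)).
Proof.
move=> yt; have yi i : is_derive t 1 (fun s => y s 0 i * y s 0 i) (2 * (dy 0 i * y t 0 i)).
  have yi := is_derive_coord 0 i yt.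
  by apply: is_derive_eq; rewrite -![_ *: _]/(_ * _); ring.
rewrite /dot mulr_sumr; have := is_derive_sum yi.
rewrite (_ : \sum_(i < n) _ = fun s => \sum_i y s 0 i * y s 0 i)//.
by rewrite funeqE => s; rewrite fct_sumE.
Qed.

End AlongCurve.

(** * Decay of the gradient in fixed time *)

Section FixedTime.
Variables (R : realType) (n : nat).
Variables (G : 'rV[R]_n -> 'rV[R]_n).
Hypotheses (Gdiff : forall x, differentiable G x)
  (JGcont : continuous (jacobian G)).

Let E z : R := dot (G z) (G z).

Lemma energy_locally_lipschitz z : locally_lipschitz_at E z.
Proof.
apply: (@locally_lipschitz_comp _ _ _ _ G (fun y => dot y y)).
  exact (locally_lipschitz_C1 Gdiff (@JGcont z)).
exact: locally_lipschitz_dot_self.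
Qed.

Lemma is_derive_energy (x : R -> 'rV[R]_n) (t : R) : derivable x t 1 ->
  is_derive t 1 (E \o x)
    (2 * dot (x^`()%classic t *m 'J G (x t)) (G (x t))).
Proof.
move=> xt; apply: (is_derive_dot_self (y := G \o x)).
apply: is_derive_comp_jacobian => //.
by rewrite derive1E; exact: derivableP.
Qed.

Variable x : R -> 'rV[R]_n.
Hypothesis x_ac : forall b, 0 < b -> abs_continuous_on 0 b x.

(** The Lyapunov inequality: half the derivative of [E] along [x] is at most
    [- c |G x|^(1 + r)]. *)
Definition dissipates (c r : R) :=
  {ae @lebesgue_measure R, forall t : R, 0 <= t -> derivable x t 1 /\
    dot (x^`()%classic t *m 'J G (x t)) (G (x t)) <=
      - (c * enorm (G (x t)) `^ (1 + r))}.

Lemma x_ac_on a b : 0 <= a -> a <= b -> abs_continuous_on a b x.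
Proof.
move=> a0 ab; have b1 : 0 < b + 1 by rewrite ltr_wpDl// (le_trans a0).
by apply: abs_continuous_on_sub (x_ac b1); rewrite // lerDl.
Qed.

Lemma energy_nonincreasing c r a b : 0 <= c -> dissipates c r ->
  0 <= a -> a <= b -> E (x b) <= E (x a).
Proof.
move=> c0 xdis a0 ab; rewrite -subr_le0 -(mul0r (b - a)).
apply: (@abs_continuous_comp_derive_le _ _ x E) => //.
- exact: x_ac_on.
- by move=> t _; exact: energy_locally_lipschitz.
apply: ae_lebesgueS xdis => t xdis /andP[at_ tb].
have [xt Et] := xdis (le_trans a0 at_).
have [dE vE] := is_derive_energy xt; split=> //.
rewrite derive1E vE mulr_ge0_le0// (le_trans Et)// oppr_le0.
by rewrite mulr_ge0// powR_ge0.
Qed.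

Lemma locally_lipschitz_scale (V : normedModType R) (f : V -> R) (p : V) k :
  locally_lipschitz_at f p -> locally_lipschitz_at (fun z => k * f z) p.
Proof.
move=> [r r0 [K K0 fK]]; exists r => //; exists ((`|k| + 1) * K).
  by rewrite mulr_gt0// ltr_wpDl.
move=> z z' zr z'r; rewrite -mulrBr normrM -mulrA ler_pM//; first by rewrite lerDl.
exact: fK.
Qed.

(** In terms of the squared norm [E] of the gradient, dissipation reads
    [E' <= - 2 c E ^ ((1 + r) / 2)], that is [E ^ al / al] decreases at rate at
    least [2 c] for [al = (1 - r) / 2]. *)
Lemma energy_power_decrease c r al a b : al = (1 - r) / 2 -> 0 <= c ->
  r != 1 -> dissipates c r -> 0 <= a -> a <= b ->
  (forall t, a <= t <= b -> 0 < E (x t)) ->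
  al^-1 * E (x b) `^ al - al^-1 * E (x a) `^ al <= - (2 * c) * (b - a).
Proof.
move=> alE c0 r1 xdis a0 ab Epos.
have al0 : al != 0.
  by rewrite alE mulf_neq0// ?invr_eq0 ?pnatr_eq0// subr_eq0 eq_sym.
apply: (@abs_continuous_comp_derive_le _ _ x (fun z => al^-1 * E z `^ al)) => //.
- exact: x_ac_on.
- move=> t /Epos Et; apply: locally_lipschitz_scale.
  apply: (@locally_lipschitz_comp _ _ _ _ E (fun e => e `^ al)).
    exact: energy_locally_lipschitz.
  exact: locally_lipschitz_powR.
apply: ae_lebesgueS xdis => t xdis tab.
have Et := Epos t tab; have /andP[at_ tb] := tab.
have [xt Edis] := xdis (le_trans a0 at_).
have DE := is_derive_energy xt.
have DP := is_derive1_powR al Et.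
have DC := @is_derive1_comp _ (fun e => e `^ al) (E \o x) t _ _ DP DE.
have [dPsi vPsi] := is_deriveZ al^-1 DC.
split; first exact: dPsi.
rewrite derive1E [leLHS]vPsi.
rewrite -[leLHS]/(al^-1 * (al * E (x t) `^ (al - 1) * _)) !mulrA mulVf// mul1r.
rewrite -[_ * 2 * _]mulrA [_ * (2 * _)]mulrC.
have pw_ge0 : 0 <= E (x t) `^ (al - 1) by exact: powR_ge0.
have := ler_wpM2l pw_ge0 Edis.
have -> : enorm (G (x t)) `^ (1 + r) = E (x t) `^ ((1 + r) / 2).
  rewrite /enorm -powR12_sqrt ?dot_ge0// -powRrM; congr (_ `^ _); first by rewrite mulrC.
rewrite mulrN mulrCA -powRD; last by apply/implyP => _; rewrite gt_eqF.
have -> : al - 1 + (1 + r) / 2 = 0 by rewrite alE; field.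
rewrite powRr0 mulr1; lra.
Qed.

(** Suppose that [E] stays positive. With [alq < 0], the power [E ^ alq] grows at
    rate at least [rho (q - 1)], so it exceeds 1, and [E] is below 1, at time [Tq]
    whatever the initial value of [E]. With [alp > 0], the power [E ^ alp], which
    is then at most 1, decreases at rate at least [sigma (1 - p)] and cannot stay
    positive for a time [Tp] longer. *)
Lemma fixed_time_zero p q sigma rho t : p < 1 -> 1 < q -> 0 < sigma -> 0 < rho ->
  dissipates sigma p -> dissipates rho q ->
  (sigma * (1 - p))^-1 + (rho * (q - 1))^-1 <= t -> G (x t) = 0.
Proof.
move=> p1 q1 s0 r0 pdis qdis.
set Tp := (sigma * (1 - p))^-1; set Tq := (rho * (q - 1))^-1 => Tt.
have sp_gt0 : 0 < sigma * (1 - p) by rewrite mulr_gt0// subr_gt0.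
have rq_gt0 : 0 < rho * (q - 1) by rewrite mulr_gt0// subr_gt0.
have Tp0 : 0 <= Tp by rewrite invr_ge0 ltW.
have Tq0 : 0 <= Tq by rewrite invr_ge0 ltW.
suff : E (x t) <= 0.
  move=> Et0; apply/eqP; rewrite -normr_eq0 eq_le normr_ge0 andbT.
  rewrite (le_trans (norm_le_enorm _))// -(ler_pXn2r (_ : 0 < 2)%N) ?nnegrE ?enorm_ge0//.
  by rewrite enorm_sqr expr0n.
rewrite leNgt; apply/negP => Et.
have Epos s : 0 <= s -> s <= Tp + Tq -> 0 < E (x s).
  move=> s0' sT; rewrite (lt_le_trans Et)//.
  by apply: (energy_nonincreasing (ltW s0) pdis) => //; exact: le_trans Tt.
pose alq := (1 - q) / 2; pose alp := (1 - p) / 2.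
have alq_lt0 : alq < 0 by rewrite /alq pmulr_llt0 ?invr_gt0// subr_lt0.
have alp_gt0 : 0 < alp by rewrite divr_gt0// subr_gt0.
have E0 : 0 < E (x 0) by apply: Epos => //; exact: addr_ge0.
have E1 : 0 < E (x Tq) by apply: Epos => //; rewrite lerDr.
have ET : 0 < E (x (Tp + Tq)) by apply: Epos => //; exact: addr_ge0.
have E1_lt1 : E (x Tq) < 1.
  have := energy_power_decrease (erefl : alq = (1 - q) / 2) (ltW r0) _ qdis (lexx 0) Tq0.
  rewrite gt_eqF// => /(_ isT) H.
  rewrite ltNge; apply/negP => E1_ge1.
  have {H} : alq^-1 * E (x Tq) `^ alq - alq^-1 * E (x 0) `^ alq <=
      - (2 * rho) * (Tq - 0).
    apply: H => s /andP[s0' sT]; apply: Epos => //.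
    by rewrite (le_trans sT)// lerDr.
  rewrite subr0 -mulrBr -(ler_nM2l alq_lt0).
  rewrite [alq * (alq^-1 * _)]mulrA mulfV ?lt_eqF// mul1r.
  have -> : alq * (- (2 * rho) * Tq) = 1.
    by rewrite /alq /Tq; field; rewrite !gt_eqF// subr_gt0.
  have E1_le1 : E (x Tq) `^ alq <= 1.
    by rewrite -(powRr0 (E (x Tq))) ler_powR// ltW.
  have := powR_gt0 alq E0; lra.
have := energy_power_decrease (erefl : alp = (1 - p) / 2) (ltW s0) _ pdis Tq0.
rewrite lt_eqF// => /(_ (Tp + Tq) isT) H.
have {H} : alp^-1 * E (x (Tp + Tq)) `^ alp - alp^-1 * E (x Tq) `^ alp <=
    - (2 * sigma) * (Tp + Tq - Tq).
  apply: H => [|s /andP[s0' sT]]; first by rewrite lerDr.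
  by apply: Epos => //; exact: le_trans s0'.
rewrite addrK -mulrBr -(ler_pM2l alp_gt0).
rewrite [alp * (alp^-1 * _)]mulrA mulfV ?gt_eqF// mul1r.
have -> : alp * (- (2 * sigma) * Tp) = - 1.
  by rewrite /alp /Tp; field; rewrite !gt_eqF// subr_gt0.
have E1_le1 : E (x Tq) `^ alp <= 1.
  have /(_ _ _ _ _ (ltW E1_lt1)) := ge0_ler_powR (ltW alp_gt0).
  by rewrite powR1 !nnegrE; apply; rewrite ?ltW.
have := powR_gt0 alp ET; lra.
Qed.

End FixedTime.

(** * Measurability of the derivative of a curve *)

Section DerivativeMeasurability.
Variables (R : realType) (n : nat).
Notation mu := (@lebesgue_measure R).
Notation outer_mu := ((@wlength R idfun)^*%mu).

Lemma measurable_caratheodory (A : set R) : measurable A -> mu.-caratheodory A.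
Proof. exact: sub_caratheodory. Qed.

Lemma negligible_caratheodory (N : set R) :
  mu.-negligible N -> mu.-caratheodory N.
Proof.
move=> /negligible_outer_measure N0.
apply: (@le_caratheodory_measurable _ _ outer_mu) => X.
apply: (@le_trans _ _ (outer_mu N + outer_mu (X `&` ~` N))%E).
  by rewrite leeD2r// le_outer_measure//; exact: subIsetr.
by rewrite N0 add0e le_outer_measure//; exact: subIsetl.
Qed.

Lemma ae_eq_caratheodory (A B : set R) : measurable B ->
  {ae mu, forall t, A t <-> B t} -> mu.-caratheodory A.
Proof.
move=> mB [N [mN N0 NAB]].
have AB t : ~ N t -> (A t <-> B t).
  by move=> Nt; apply: contrapT => H; apply: Nt; exact: NAB.
have -> : A = (B `\` N) `|` (A `&` N).
  apply/seteqP; split=> t.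
    move=> At; have [Nt|Nt] := pselect (N t); [by right|left].
    by split => //; exact/(AB t Nt).
  by case=> [[Bt Nt]|[]//]; exact/(AB t Nt).
apply: (@caratheodory_measurable_setU _ _ outer_mu).
  by apply: measurable_caratheodory; exact: measurableD.
by apply: negligible_caratheodory; exists N; split => //; exact: subIsetr.
Qed.

Implicit Types (x : R -> 'rV[R]_n) (U : set 'rV[R]_n).

Definition quotient_seq x (k : nat) (t : R) : 'rV[R]_n :=
  k.+1%:R *: (x (t + k.+1%:R^-1) - x t).

Lemma quotient_seq_cvg x t e : derivable x t 1 -> 0 < e ->
  exists K, forall k, (K <= k)%N -> `|quotient_seq x k t - x^`()%classic t| < e.
Proof.
move=> xt e_gt0; have := xt; rewrite /derivable => /cvgrPdist_lt /(_ _ e_gt0).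
rewrite -[lim _]/('D_1 x t) -derive1E => /nbhs_ballP[r /= r_gt0 xr].
have [K _ Kr] := near_infty_natSinv_lt (PosNum r_gt0).
exists K => k /Kr /= kr; rewrite distrC.
have k_neq0 : (k.+1%:R : R)^-1 != 0 by rewrite invr_eq0.
have /(_ k.+1%:R^-1) := xr; rewrite -ball_normE /ball_/= sub0r normrN.
rewrite gtr0_norm ?invr_gt0// => /(_ kr k_neq0).
by rewrite invrK [_%:A]mulr1 [_ + t]addrC.
Qed.

(** These sets are closed and exhaust an open [U]. *)
Definition inner_part U (m : nat) : set 'rV[R]_n :=
  [set y | ball y (m.+1%:R^-1) `<=` U].

Lemma closed_inner_part U m : closed (inner_part U m).
Proof.
move=> p pU z; rewrite -ball_normE /ball_/= => pz.
have d_gt0 : 0 < m.+1%:R^-1 - `|p - z| by rewrite subr_gt0.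
have [y [yU]] := pU _ (nbhsx_ballx p _ d_gt0).
rewrite -ball_normE /ball_/= => py; apply: yU.
rewrite -ball_normE /ball_/= -(subrKA p) (le_lt_trans (ler_normD _ _))//.
by rewrite -ltrBrDr distrC.
Qed.

(** Membership of a limit in an open set is a countable condition on the terms of
    the sequence, involving closed sets only. *)
Lemma cvg_open_iff (w : nat -> 'rV[R]_n) l U : open U ->
  (forall e, 0 < e -> exists K, forall k, (K <= k)%N -> `|w k - l| < e) ->
  U l <-> exists m K, forall k, (K <= k)%N -> inner_part U m (w k).
Proof.
move=> oU wl; split=> [Ul|[m [K wU]]].
  have /nbhs_ballP[r /= r_gt0 rU] : nbhs l U by apply: open_nbhs_nbhs.
  have r2_gt0 : 0 < r / 2 by rewrite divr_gt0.
  have [m _ mr] := near_infty_natSinv_lt (PosNum r2_gt0).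
  have [K wK] := wl _ r2_gt0; exists m, K => k /wK wkl z.
  rewrite -ball_normE /ball_/= => wz; apply: rU.
  rewrite -ball_normE /ball_/= -(subrKA (w k)) (le_lt_trans (ler_normD _ _))//.
  have mr2 : m.+1%:R^-1 < r / 2 := mr m (leqnn m).
  by rewrite distrC [ltRHS]splitr ltrD// (lt_trans wz).
have m_gt0 : 0 < m.+1%:R^-1 :> R by rewrite invr_gt0.
have [K' wK'] := wl _ m_gt0.
apply: (wU (maxn K K') (leq_maxl _ _)).
by rewrite -ball_normE /ball_/=; apply: wK'; exact: leq_maxr.
Qed.

Lemma derivative_measurable_map x (v : R -> 'rV[R]_n) (T : R) :
  (forall b, 0 < b -> abs_continuous_on 0 b x) ->
  {ae mu, forall t : R, 0 <= t -> derivable x t 1 /\ x^`()%classic t = - v t} ->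
  measurable_map mu `[0, T] v.
Proof.
move=> xac xae U oU.
(* [x] may be discontinuous at negative times. *)
pose y t := x (Num.max 0 t).
have y_cont : continuous y.
  move=> t; apply/cvgrPdist_lt => e e_gt0.
  have c0 : 0 <= Num.max 0 t by rewrite le_max lexx.
  have b_gt0 : 0 < Num.max 0 t + 1 by rewrite ltr_wpDl.
  have [|||r r_gt0 xr] := @abs_continuous_on_cvg _ _ x 0
    (Num.max 0 t + 1) (Num.max 0 t) e.
  - exact: xac.
  - by rewrite c0 lerDl ler01.
  - by [].
  have r1_gt0 : 0 < Num.min r 1 by rewrite lt_min r_gt0 ltr01.
  apply/nbhs_ballP; exists (Num.min r 1) => // s.
  change (`|t - s| < Num.min r 1 -> `|y t - y s| < e).
  rewrite lt_min => /andP[tr t1].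
  have st : `|Num.max 0 s - Num.max 0 t| <= `|t - s|.
    rewrite distrC ler_norml; move: (ler_norm (t - s)) (ler_norm (s - t)).
    rewrite (distrC s t); case: (leP 0 s); case: (leP 0 t) => ? ? ? ?;
      apply/andP; split; lra.
  rewrite distrC; apply: xr; last exact: le_lt_trans tr.
  rewrite le_max lexx/= -lerBlDl (le_trans (ler_norm _))// (le_trans st)//.
  exact: ltW.
have q_cont k : continuous (quotient_seq y k).
  move=> t; apply: cvgZl_tmp; apply: cvgB; last exact: y_cont.
  apply: continuous_comp; last exact: y_cont.
  by apply: cvgD; [exact: cvg_id|exact: cvg_cst].
pose B m K := \bigcap_(k in [set k | (K <= k)%N])
    (quotient_seq y k @^-1` inner_part (-%R @^-1` U) m).
have mB m K : measurable (B m K : set R).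
  apply: bigcap_measurable => [|k _]; first by exists K => /=.
  apply: measurable_realfun.closed_measurable.
  by apply: closed_comp => [t _|]; [exact: q_cont|exact: closed_inner_part].
apply: (@ae_eq_caratheodory _ (`[0, T] `&` \bigcup_m \bigcup_K B m K)).
  apply: measurableI; first exact: measurable_itv.
  by apply: bigcupT_measurable => m; exact: bigcupT_measurable.
apply: ae_lebesgueS xae => t xt.
suff : `[0, T]%classic t -> U (v t) <-> (\bigcup_m \bigcup_K B m K) t.
  by move=> H; split=> -[tT] /(H tT).
rewrite /= in_itv/= => /andP[t0 _]; have [xder xv] := xt t0.
have NU : open (-%R @^-1` U : set 'rV[R]_n).
  by apply: open_comp => // z _; exact: opp_continuous.
have yq e : 0 < e -> exists K, forall k, (K <= k)%N ->
    `|quotient_seq y k t - (- v t)| < e.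
  rewrite -xv => /(quotient_seq_cvg xder)[K xK]; exists K => k /xK.
  by rewrite /quotient_seq /y !max_r// addr_ge0.
have -> : U (v t) = (-%R @^-1` U) (- v t) by rewrite /= opprK.
rewrite (cvg_open_iff NU yq); split=> [[m [K H]]|[m _ [K _ H]]].
  by exists m => //; exists K.
by exists m, K.
Qed.

Lemma negligible_lebesgue0 (A : set R) : mu.-negligible A -> mu A = 0%E.
Proof. by move=> /negligible_outer_measure. Qed.

End DerivativeMeasurability.

(** * Gradients of functions with positive definite Hessian *)

Section Gradient.
Variables (R : realType) (n : nat).

Lemma is_derive_comp_line (f : 'rV[R]_n -> R) (z d : 'rV[R]_n) (t : R) :
  differentiable f (z + t *: d) ->
  is_derive t 1 (fun s => f (z + s *: d)) ('D_d f (z + t *: d)).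
Proof.
move=> ft; have [/derivable1_diffP lt lv] := is_derive_line z d t.
split; first by apply/derivable1_diffP; exact: differentiable_comp.
rewrite (deriveE _ (@differentiable_comp _ _ _ _ (fun s : R => z + s *: d) f t lt ft)).
rewrite (diff_comp (f := fun s : R => z + s *: d) (g := f) lt ft) /=.
by rewrite -(deriveE _ lt) lv deriveE.
Qed.

Lemma grad_at_min (f : 'rV[R]_n -> R) xstar :
  (forall x, differentiable f x) -> (forall y, f xstar <= f y) ->
  grad f xstar = 0.
Proof.
move=> fdiff fmin; apply/rowP => i; rewrite !mxE.
set d := delta_mx 0 i.
pose phi (s : R) := f (xstar + s *: d).
have Dphi (s : R) : is_derive s 1 phi ('D_d f (xstar + s *: d)).
  exact: is_derive_comp_line.
have in01 : (0 : R) \in `](-1), 1[ by rewrite in_itv/= ltr01 ltrN10.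
have [|s _|s _|_ phi0] := @derive1_at_min R phi (-1) 1 0 _ _ in01.
- by rewrite (le_trans (lerN10 R))// ler01.
- by have [] := Dphi s.
- by rewrite /phi scale0r addr0.
by have [_] := Dphi 0; rewrite phi0 scale0r addr0 => <-.
Qed.

Lemma is_derive_dotl (y : R -> 'rV[R]_n) (t : R) dy d : is_derive t 1 y dy ->
  is_derive t 1 (fun s => dot (y s) d) (dot dy d).
Proof.
move=> yt; have yi i : is_derive t 1 (fun s => y s 0 i * d 0 i) (dy 0 i * d 0 i).
  have yi := is_derive_coord 0 i yt.
  by apply: is_derive_eq; rewrite -![_ *: _]/(_ * _); ring.
rewrite /dot; have := is_derive_sum yi.
rewrite (_ : \sum_(i < n) _ = fun s => \sum_i y s 0 i * d 0 i)//.
by rewrite funeqE => s; rewrite fct_sumE.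
Qed.

(** Along the segment from [z'] to [z = z' + d], the scalar product of [G] with
    [d] is strictly increasing. *)
Lemma posdef_jacobian_inj (G : 'rV[R]_n -> 'rV[R]_n) :
  (forall x, differentiable G x) -> (forall x, posdef ('J G x)) ->
  injective G.
Proof.
move=> Gdiff Gpos z z' Gzz'; apply/eqP; rewrite -subr_eq0; apply/negP => /negP d0.
set d := z - z' in d0.
have Dphi (t : R) : is_derive t 1 (fun s => dot (G (z' + s *: d)) d)
    (dot (d *m 'J G (z' + t *: d)) d).
  apply: (is_derive_dotl (y := fun s => G (z' + s *: d))).
  exact: is_derive_comp_jacobian (is_derive_line z' d t) (Gdiff _).
have [c _] := mean_value01 Dphi.
rewrite scale1r scale0r addr0 [z' + d]addrC subrK Gzz' subrr => /esym/eqP.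
by rewrite gt_eqF//; exact: Gpos.
Qed.

End Gradient.

(** * The gradient-based feedback *)

Lemma class_F_dot_ge (R : realType) n (p sigma : R)
    (g : 'rV[R]_n -> 'rV[R]_n) y eta :
  class_F p sigma g -> filippov g y eta ->
  sigma * enorm y `^ (1 + p) <= dot eta y.
Proof.
by move=> [_ _ _ /(_ y)[eta0 [_ etamin le0]]] /etamin; exact: le_trans.
Qed.

Section Solution.
Variables (R : realType) (n : nat) (G : 'rV[R]_n.+1 -> 'rV[R]_n.+1).
Hypotheses (Gdiff : forall x, differentiable G x)
  (JGcont : continuous (jacobian G)) (JGpos : forall x, posdef ('J G x)).
Variables (gp gq : 'rV[R]_n.+1 -> 'rV[R]_n.+1) (p q sigma rho : R).
Hypotheses (gpF : class_F p sigma gp) (gqF : class_F q rho gq).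

Let g y := gp y + gq y.
Let u z := g (G z) *m invmx ('J G z).

Let JGunit z : 'J G z \in unitmx.
Proof. exact: posdef_unitmx. Qed.

Lemma sum_ess_bounded y : exists M, ess_near y [set z | `|g z| <= M].
Proof.
have [_ gpb _ _] := gpF; have [_ gqb _ _] := gqF.
have [M1 gpM] := ess_near_bounded y gpb; have [M2 gqM] := ess_near_bounded y gqb.
exists (M1 + M2); move: gpM gqM; apply: filterS2 => z /= zM1 zM2.
by rewrite (le_trans (ler_normD _ _))// lerD.
Qed.

Lemma feedback_dissipation x v : filippov (fun z => - u z) x v ->
  dot (v *m 'J G x) (G x) <=
    - (sigma * enorm (G x) `^ (1 + p) + rho * enorm (G x) `^ (1 + q)).
Proof.
have [M gM] := sum_ess_bounded (G x).
apply: (feedback_filippov_dot Gdiff JGcont JGunit gM) => e e_gt0.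
have e2_gt0 : 0 < e / 2 by rewrite divr_gt0.
have [_ gpb _ _] := gpF; have [_ gqb _ _] := gqF.
have [M1 gpM] := ess_near_bounded (G x) gpb.
have [M2 gqM] := ess_near_bounded (G x) gqb.
have gp_near := filippov_halfspace_usc gpM (fun=> class_F_dot_ge gpF) e2_gt0.
have gq_near := filippov_halfspace_usc gqM (fun=> class_F_dot_ge gqF) e2_gt0.
by move: gp_near gq_near; apply: filterS2 => z /=; rewrite dotDl; lra.
Qed.

Variables (x0 : 'rV[R]_n.+1) (x : R -> 'rV[R]_n.+1).
Hypothesis x_sol : filippov_solution (fun z => - u z) x0 x.
Hypotheses (sigma_gt0 : 0 < sigma) (rho_gt0 : 0 < rho).

Lemma solution_dissipates : dissipates G x sigma p /\ dissipates G x rho q.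
Proof.
have [_ _ x_ae] := x_sol.
have pw_ge0 r c t : 0 < c -> 0 <= c * enorm (G (x t)) `^ r.
  by move=> c0; rewrite mulr_ge0 ?powR_ge0// ltW.
split; apply: ae_lebesgueS x_ae => t xt /xt[xder /feedback_dissipation xdis];
  split=> //; rewrite (le_trans xdis)// lerN2.
  by rewrite lerDl pw_ge0.
by rewrite lerDr pw_ge0.
Qed.

Lemma feedback_along_exists : exists v, feedback_along u x v.
Proof.
have [_ _ x_ae] := x_sol; exists (fun t => - x^`()%classic t).
apply: ae_lebesgueS x_ae => t xt /xt[xder xF]; split => //.
  exact: filippovN.
by rewrite opprK.
Qed.

Lemma feedback_along_regular v T : feedback_along u x v ->
  measurable_map (@lebesgue_measure R) `[0, T] v /\
  locally_ess_bounded (@lebesgue_measure R) `[0, T] v.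
Proof.
move=> v_ae; have [_ x_ac _] := x_sol; split.
  apply: (@derivative_measurable_map _ _ x v T x_ac).
  by apply: ae_lebesgueS v_ae => t vt /vt[].
move=> t0 /=; rewrite in_itv/= => /andP[t0_ge0 t0T].
have [M gM] := sum_ess_bounded (G (x t0)).
have [M' /nbhs_ballP[r /= r_gt0 uM']] :=
  feedback_filippov_bounded Gdiff JGcont JGunit gM.
have t0in : 0 <= t0 <= T + 1 by rewrite t0_ge0 (le_trans t0T)// lerDl ler01.
have T1_gt0 : 0 < T + 1 by rewrite ltr_wpDl ?ltr01// (le_trans t0_ge0).
have [d d_gt0 xd] := abs_continuous_on_cvg (x_ac _ T1_gt0) t0in r_gt0.
exists (ball t0 d); first exact: nbhsx_ballx.
exists (n.+1%:R * M'); apply: negligible_lebesgue0.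
apply: negligibleS v_ae => t [[td tT] vM] vt.
move: tT; rewrite /= in_itv/= => /andP[t_ge0 tT].
have [/uM' vM' _ _] := vt t_ge0.
move: vM; rewrite /= ltNge (le_trans (enorm_le_norm _))//.
rewrite ler_wpM2l// vM'// -ball_normE /ball_/= distrC; apply: xd.
  by rewrite t_ge0 (le_trans tT)// lerDl ler01.
by move: td; rewrite -ball_normE /ball_/= distrC.
Qed.

End Solution.

Unset Implicit Arguments.
Set Strict Implicit.
Set Printing Implicit Defensive.

Theorem theorem3 (R : realType) (n : nat) (f : 'rV[R]_n -> R)
    (xstar : 'rV[R]_n) (gp gq : 'rV[R]_n -> 'rV[R]_n) (p q sigma rho : R)
    (n_gt0 : (0 < n)%N)
    (f_convex : strictly_convex f)
    (f_C2 : twice_cont_diff f)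
    (f_hess : forall x, posdef (hess f x))
    (f_min : forall y, f xstar <= f y)
    (p_ge0 : 0 <= p) (p_lt1 : p < 1) (q_gt1 : 1 < q)
    (sigma_gt0 : 0 < sigma) (rho_gt0 : 0 < rho)
    (gpF : class_F p sigma gp) (gqF : class_F q rho gq) :
  let g := fun y => gp y + gq y in
  (* the row-vector form of (hess f x)^-1 g(grad f x) *)
  let u := fun x => g (grad f x) *m invmx (hess f x) in
  exists T : 'rV[R]_n -> R,
    forall x0 : 'rV[R]_n,
      [/\ 0 <= T x0,
          T x0 <= (sigma * (1 - p))^-1 + (rho * (q - 1))^-1 &
          forall x : R -> 'rV[R]_n,
            filippov_solution (fun y => - u y) x0 x ->
            [/\ forall t, T x0 <= t -> x t = xstar,
                exists v, feedback_along u x v &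
                forall v, feedback_along u x v ->
                  measurable_map (@lebesgue_measure R) `[0, T x0] v /\
                  locally_ess_bounded (@lebesgue_measure R) `[0, T x0] v]].
Proof.
case: n f xstar gp gq n_gt0 f_convex f_C2 f_hess f_min gpF gqF => // {}n {}f
  {}xstar {}gp {}gq _ _ [f_diff G_diff JG_cont] f_hess f_min gpF gqF g u.
have sp_gt0 : 0 < sigma * (1 - p) by rewrite mulr_gt0// subr_gt0.
have rq_gt0 : 0 < rho * (q - 1) by rewrite mulr_gt0// subr_gt0.
pose T := (sigma * (1 - p))^-1 + (rho * (q - 1))^-1.
exists (fun=> T) => x0; split => [||x x_sol].
- by rewrite addr_ge0// invr_ge0 ltW.
- exact: lexx.
have [_ x_ac _] := x_sol.
have [pdis qdis] := solution_dissipates G_diff JG_cont f_hess gpF gqF x_sol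
  sigma_gt0 rho_gt0.
split.
- move=> t Tt; apply: (posdef_jacobian_inj G_diff f_hess).
  rewrite (grad_at_min f_diff f_min).
  exact: (fixed_time_zero G_diff JG_cont x_ac p_lt1 q_gt1 sigma_gt0 rho_gt0
    pdis qdis Tt).
- exact: feedback_along_exists x_sol.
- by move=> v; exact: (feedback_along_regular G_diff JG_cont f_hess gpF gqF x_sol).
Qed.
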